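(* For a Finsler manifold $(M,L)$, the following assertions are equivalent: (a) $(M,L)$ is $S^v$-recurrent; (b) the $v$-curvature tensor $S$ vanishes identically; (c) $(M,L)$ is $S^v$-recurrent of the second order.
   Context: Setting. $M$ is a smooth manifold of finite dimension $n$, $\pi:\mathcal{T}M\to M$ is the bundle of nonzero tangent vectors, $\pi^{-1}(TM)\to\mathcal{T}M$ is the pullback of $TM$ by $\pi$, and $\mathfrak{X}(\pi(M))$ is the module of its smooth sections ($\pi$-vector fields, written $\overline{X}$). Tensor fields on the bundle $\pi^{-1}(TM)$ are called $\pi$-tensor fields; a $\pi$-form of order $p$ is a $\pi$-tensor field of type $(0,p)$. $\overline{\eta}(u)=(u,u)$ is the fundamental $\pi$-vector field. $\rho:T(\mathcal{T}M)\to\pi^{-1}(TM)$ is $\rho=(\pi_{\mathcal{T}M},d\pi)$ and $\gamma:\pi^{-1}(TM)\to V(\mathcal{T}M)$ is the natural isomorphism (vertical lift) onto the vertical bundle. $(M,L)$ is a Finsler manifold ($L$ positively homogeneous of degree $1$, smooth on $\mathcal{T}M$, with positive definite metric $g$ on $\pi^{-1}(TM)$ of components $g_{ij}=\frac12\partial^2L^2/\partial y^i\partial y^j$). A linear connection $\nabla$ in $\pi^{-1}(TM)$ is regular if, with $K(X)=\nabla_X\overline{\eta}$ and $H(\mathcal{T}M)=\ker K$, one has $T(\mathcal{T}M)=V(\mathcal{T}M)\oplus H(\mathcal{T}M)$; then $\beta=(\rho|_{H(\mathcal{T}M)})^{-1}$. Its torsion is $\mathbf{T}(X,Y)=\nabla_X\rho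 Y-\nabla_Y\rho X-\rho[X,Y]$; put $Q(\overline{X},\overline{Y})=\mathbf{T}(\beta\overline{X},\beta\overline{Y})$ and $T(\overline{X},\overline{Y})=\mathbf{T}(\gamma\overline{X},\beta\overline{Y})$. Throughout, $\nabla$ is the Cartan connection: the unique regular connection with $\nabla g=0$, $Q=0$ and $g(T(\overline{X},\overline{Y}),\overline{Z})=g(T(\overline{X},\overline{Z}),\overline{Y})$. Its classical curvature is $\mathbf{K}(X,Y)\rho Z=-\nabla_X\nabla_Y\rho Z+\nabla_Y\nabla_X\rho Z+\nabla_{[X,Y]}\rho Z$ and its vertical ($v$-) curvature tensor is $S(\overline{X},\overline{Y})\overline{Z}=\mathbf{K}(\gamma\overline{X},\gamma\overline{Y})\overline{Z}$, also regarded as the $\pi$-tensor $S(\overline{X},\overline{Y},\overline{Z})$. For a $\pi$-tensor field $A$, $\stackrel{2}{\nabla}A$ is the $\pi$-tensor field $(\stackrel{2}{\nabla}A)(\overline{X},\dots)=(\nabla_{\gamma\overline{X}}A)(\dots)$; thus $(\stackrel{2}{\nabla}\stackrel{2}{\nabla}S)(\overline{Y},\overline{X},\cdot,\cdot,\cdot)=\big(\nabla_{\gamma\overline{Y}}(\nabla_{\gamma\overline{X}}S)-\nabla_{\gamma\nabla_{\gamma\overline{Y}}\overline{X}}S\big)(\cdot,\cdot,\cdot)$. Definitions. $(M,L)$ is $S^v$-recurrent if there is a $\pi$-form $\lambda$ of order one with $(\nabla_{\gamma\overline{X}}S)(\overline{Y},\overline{Z},\overline{W})=\lambda(\overline{X})S(\overline{Y},\overline{Z})\overline{W}$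 for all arguments. It is $S^v$-recurrent of the second order if there is a $\pi$-form $\Theta$ of order two with $(\stackrel{2}{\nabla}\stackrel{2}{\nabla}S)(\overline{Y},\overline{X},\overline{Z},\overline{W},\overline{U})=\Theta(\overline{X},\overline{Y})S(\overline{Z},\overline{W})\overline{U}$ for all arguments. *)

(* Defs.v *)
From HB Require Import structures.
From mathcomp Require Import all_boot all_order all_algebra.
From mathcomp Require Import all_classical all_reals all_analysis.
Set Implicit Arguments.
Unset Strict Implicit.
Unset Printing Implicit Defensive.
Import Order.TTheory GRing.Theory Num.Theory.
Import numFieldNormedType.Exports.
Local Open Scope classical_set_scope.
Local Open Scope ring_scope.

(* Meant for [O] open in a finite-dimensional [V], where it is the usual C^k. *)
Fixpoint Ck (R : realType) (V W : normedModType R) (k : nat) (O : set V)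
    (f : V -> W) : Prop :=
  match k with
  | 0%N => forall x, O x -> {for x, continuous f}
  | k'.+1 => (forall x, O x -> differentiable f x) /\
             (forall v, Ck k' O (fun x => 'D_v f x))
  end.

Definition smooth_on (R : realType) (V W : normedModType R) (O : set V)
    (f : V -> W) : Prop :=
  forall k, Ck k O f.

(* ** Charts, tangent vectors and vector fields

   A tangent vector at [p] is represented by its coordinates in the preferred
   chart [chart_at p], so that every tangent space is 'rV_n; [tcoord] gives the
   coordinates of the same tangent vector in another chart.  The preferred chart
   need not depend continuously on the point, hence smoothness, openness in the
   tangent bundle, etc. are always tested in the fixed charts of the atlas.
   [chart_inv i] is significant only on the image of [chart_dom i]. *)
Record chartedSpace (R : realType) (n : nat) (T : Type) := ChartedSpace {
  chart_index : Type;
  chart_dom : chart_index -> set T;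
  chart : chart_index -> T -> 'rV[R]_n;
  chart_inv : chart_index -> 'rV[R]_n -> T;
  chart_at : T -> chart_index
}.

Section Charts.
Variables (R : realType) (n : nat) (T : Type) (A : chartedSpace R n T).

Definition chart_image (i : chart_index A) (W : set T) : set 'rV[R]_n :=
  chart i @` (W `&` chart_dom i).

Definition transition (i j : chart_index A) (x : 'rV[R]_n) : 'rV[R]_n :=
  chart j (chart_inv i x).

Definition chart_open (W : set T) : Prop :=
  forall i : chart_index A, open (chart_image i W).

Definition here (p : T) : 'rV[R]_n := chart (chart_at A p) p.

Definition tcoord (i : chart_index A) (p : T) (v : 'rV[R]_n) : 'rV[R]_n :=
  'D_v (transition (chart_at A p) i) (here p).

Definition smooth_function (W : set T) (f : T -> R) : Prop :=
  forall i : chart_index A,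
    smooth_on (chart_image i W) (fun x => f (chart_inv i x)).

Definition function_deriv (f : T -> R) (p : T) (v : 'rV[R]_n) : R :=
  'D_v (fun x => f (chart_inv (chart_at A p) x)) (here p).

Definition vf_coord (i : chart_index A) (X : T -> 'rV[R]_n)
    (x : 'rV[R]_n) : 'rV[R]_n :=
  let p := chart_inv i x in tcoord i p (X p).

Definition smooth_vector_field (W : set T) (X : T -> 'rV[R]_n) : Prop :=
  forall i : chart_index A, smooth_on (chart_image i W) (vf_coord i X).

Definition lie_bracket (X Y : T -> 'rV[R]_n) (p : T) : 'rV[R]_n :=
  let i := chart_at A p in
  'D_(X p) (vf_coord i Y) (here p) - 'D_(Y p) (vf_coord i X) (here p).

End Charts.

Definition map_deriv (R : realType) (m n : nat) (T U : Type)
    (A : chartedSpace R m T) (B : chartedSpace R n U) (f : T -> U)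
    (p : T) (v : 'rV[R]_m) : 'rV[R]_n :=
  'D_v (fun x => chart (chart_at B (f p)) (f (chart_inv (chart_at A p) x)))
       (here A p).

Record smooth_manifold (R : realType) (n : nat) (M : topologicalType)
    (A : chartedSpace R n M) : Prop := {
  manifold_hausdorff : hausdorff_space M;
  manifold_second_countable : @second_countable M;
  chart_at_dom : forall p, chart_dom (chart_at A p) p;
  chart_dom_open : forall i : chart_index A, open (chart_dom i);
  chart_image_open : forall i : chart_index A, open (chart i @` chart_dom i);
  chartK : forall (i : chart_index A) p,
    chart_dom i p -> chart_inv i (chart i p) = p;
  chart_continuous : forall (i : chart_index A) p,
    chart_dom i p -> {for p, continuous (chart i)};
  chart_inv_continuous : forall (i : chart_index A) x,
    (chart i @` chart_dom i) x -> {for x, continuous (chart_inv i)};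
  transition_smooth : forall i j : chart_index A,
    smooth_on (chart_image i (chart_dom j)) (transition i j)
}.

(* ** The tangent bundle

   The carrier of TM is M * 'rV_n, with the representation of tangent vectors
   above; its topology is the one given by [chart_open], not the product
   topology. *)
Definition tangent_bundle (R : realType) (n : nat) (T : Type)
    (A : chartedSpace R n T) : chartedSpace R (n + n) (T * 'rV[R]_n) :=
  {| chart_index := chart_index A;
     chart_dom := fun i => [set u | chart_dom i u.1];
     chart := fun i u => row_mx (chart i u.1) (tcoord i u.1 u.2);
     chart_inv := fun i z =>
       let p := chart_inv i (lsubmx z) in
       (p, 'D_(rsubmx z) (transition i (chart_at A p)) (lsubmx z));
     chart_at := fun u => chart_at A u.1 |}.

Section PiGeometry.
Variables (R : realType) (n : nat) (M : topologicalType).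
Variable A : chartedSpace R n M.

Local Notation TM := (M * 'rV[R]_n)%type.
Local Notation TMc := (tangent_bundle A).
(* [pi_field]: section of pi^{-1}(TM); [tm_field]: vector field on TM.  Fields
   are total functions, of which only the values on the open set under
   consideration matter. *)
Local Notation pi_field := (TM -> 'rV[R]_n).
Local Notation tm_field := (TM -> 'rV[R]_(n + n)).

Definition slit : set TM := [set u | u.2 != 0].

Definition slit_open (W : set TM) : Prop := chart_open TMc W /\ W `<=` slit.

Definition smooth_pi_field (W : set TM) (X : pi_field) : Prop :=
  forall i : chart_index A,
    smooth_on (chart_image (A := TMc) i W)
      (fun z => let u := chart_inv (c := TMc) i z in tcoord i u.1 (X u)).

Definition eta : pi_field := fun u => u.2.

(* The component d(pi) of rho = (pi_TM, d pi). *)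
Definition rho (u : TM) (v : 'rV[R]_(n + n)) : 'rV[R]_n :=
  map_deriv TMc A fst u v.

Definition gamma (u : TM) (w : 'rV[R]_n) : 'rV[R]_(n + n) :=
  derive1 (fun t : R =>
     chart (c := TMc) (chart_at TMc u) (u.1, u.2 + t *: w)) 0.

Definition rhof (X : tm_field) : pi_field := fun u => rho u (X u).
Definition gammaf (X : pi_field) : tm_field := fun u => gamma u (X u).

Definition finsler_metric (L : TM -> R) (u : TM) (v w : 'rV[R]_n) : R :=
  2^-1 * 'D_v (fun y => 'D_w (fun z => L (u.1, z) ^+ 2) y) u.2.

Record finsler_manifold (L : TM -> R) : Prop := {
  finsler_smooth : smooth_function TMc slit L;
  finsler_homogeneous : forall (p : M) (y : 'rV[R]_n) (t : R),
    y != 0 -> 0 < t -> L (p, t *: y) = t * L (p, y);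
  finsler_posdef : forall (u : TM) (v : 'rV[R]_n),
    slit u -> v != 0 -> 0 < finsler_metric L u v v
}.

(* ** Linear connections in pi^{-1}(TM)

   [nabla Y u v] is the covariant derivative at [u], in the direction of the
   tangent vector [v] of TM at [u], of the section [Y].  Sections and vector
   fields are taken over arbitrary open subsets of the slit tangent bundle (the
   whole of it included); by locality and the existence of cut-off functions
   this is the same notion as with globally defined fields only. *)

Definition connection := pi_field -> forall u : TM, 'rV[R]_(n + n) -> 'rV[R]_n.

Record linear_connection (nabla : connection) : Prop := {
  nabla_linear : forall W Y u, slit_open W -> smooth_pi_field W Y -> W u ->
    forall (a : R) v w,
      nabla Y u (a *: v + w) = a *: nabla Y u v + nabla Y u w;
  nabla_add : forall W Y Z u, slit_open W ->
    smooth_pi_field W Y -> smooth_pi_field W Z -> W u ->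
    forall v, nabla (fun w => Y w + Z w) u v = nabla Y u v + nabla Z u v;
  nabla_leibniz : forall W (f : TM -> R) Y u, slit_open W ->
    smooth_function TMc W f -> smooth_pi_field W Y -> W u ->
    forall v, nabla (fun w => f w *: Y w) u v =
              function_deriv TMc f u v *: Y u + f u *: nabla Y u v;
  nabla_local : forall W Y Z u, slit_open W ->
    smooth_pi_field W Y -> smooth_pi_field W Z -> W u ->
    (forall w, W w -> Y w = Z w) ->
    forall v, nabla Y u v = nabla Z u v;
  nabla_smooth : forall W (X : tm_field) Y, slit_open W ->
    smooth_vector_field TMc W X -> smooth_pi_field W Y ->
    smooth_pi_field W (fun u => nabla Y u (X u))
}.

Section Connection.
Variable nabla : connection.

Definition cov (X : tm_field) (Y : pi_field) : pi_field :=
  fun u => nabla Y u (X u).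

Definition deflection (u : TM) (v : 'rV[R]_(n + n)) : 'rV[R]_n :=
  nabla eta u v.

Definition vertical (u : TM) (v : 'rV[R]_(n + n)) : Prop := rho u v = 0.
Definition horizontal (u : TM) (v : 'rV[R]_(n + n)) : Prop :=
  deflection u v = 0.

Definition regular : Prop :=
  forall u, slit u ->
    (forall v, exists a b, [/\ vertical u a, horizontal u b & v = a + b]) /\
    (forall v, vertical u v -> horizontal u v -> v = 0).

Definition beta (u : TM) (X : 'rV[R]_n) : 'rV[R]_(n + n) :=
  xget 0 [set v | horizontal u v /\ rho u v = X].
Definition betaf (X : pi_field) : tm_field := fun u => beta u (X u).

Definition torsion (X Y : tm_field) : pi_field := fun u =>
  cov X (rhof Y) u - cov Y (rhof X) u - rho u (lie_bracket TMc X Y u).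

Definition torsionQ (X Y : pi_field) : pi_field :=
  torsion (betaf X) (betaf Y).
Definition torsionT (X Y : pi_field) : pi_field :=
  torsion (gammaf X) (betaf Y).

Record cartan_connection (L : TM -> R) : Prop := {
  cartan_linear : linear_connection nabla;
  cartan_regular : regular;
  cartan_metric : forall W Y Z u, slit_open W ->
    smooth_pi_field W Y -> smooth_pi_field W Z -> W u ->
    forall v,
      function_deriv TMc (fun w => finsler_metric L w (Y w) (Z w)) u v =
      finsler_metric L u (nabla Y u v) (Z u) +
      finsler_metric L u (Y u) (nabla Z u v);
  cartan_Q : forall W X Y u, slit_open W ->
    smooth_pi_field W X -> smooth_pi_field W Y -> W u ->
    torsionQ X Y u = 0;
  cartan_T : forall W X Y Z u, slit_open W ->
    smooth_pi_field W X -> smooth_pi_field W Y -> smooth_pi_field W Z -> W u ->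
    finsler_metric L u (torsionT X Y u) (Z u) =
    finsler_metric L u (torsionT X Z u) (Y u)
}.

Definition curvature (X Y : tm_field) (Z : pi_field) : pi_field := fun u =>
  - cov X (cov Y Z) u + cov Y (cov X Z) u + cov (lie_bracket TMc X Y) Z u.

Definition v_curvature (X Y Z : pi_field) : pi_field :=
  curvature (gammaf X) (gammaf Y) Z.

(* ** Vertical covariant derivatives of type (1,3) pi-tensor fields, regarded as
   operators on sections *)

Definition pi_tensor13 := pi_field -> pi_field -> pi_field -> pi_field.

Definition vcov (X : pi_field) (S : pi_tensor13) : pi_tensor13 :=
  fun Y Z W u =>
    cov (gammaf X) (S Y Z W) u
    - S (cov (gammaf X) Y) Z W u
    - S Y (cov (gammaf X) Z) W u
    - S Y Z (cov (gammaf X) W) u.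

Definition vcov2 (S : pi_tensor13) (Y X : pi_field) : pi_tensor13 :=
  fun Z W U u =>
    vcov Y (vcov X S) Z W U u - vcov (cov (gammaf Y) X) S Z W U u.

Definition pi_form1 (lam : TM -> 'rV[R]_n -> R) : Prop :=
  (forall u, slit u -> forall (a : R) x y,
     lam u (a *: x + y) = a * lam u x + lam u y) /\
  (forall W X, slit_open W -> smooth_pi_field W X ->
     smooth_function TMc W (fun u => lam u (X u))).

Definition pi_form2 (Theta : TM -> 'rV[R]_n -> 'rV[R]_n -> R) : Prop :=
  [/\ forall u, slit u -> forall (a : R) x y z,
        Theta u (a *: x + y) z = a * Theta u x z + Theta u y z,
      forall u, slit u -> forall (a : R) x y z,
        Theta u z (a *: x + y) = a * Theta u z x + Theta u z y
    & forall W X Y, slit_open W ->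
        smooth_pi_field W X -> smooth_pi_field W Y ->
        smooth_function TMc W (fun u => Theta u (X u) (Y u))].

Definition Sv_recurrent : Prop :=
  exists lam, pi_form1 lam /\
    forall O X Y Z W, slit_open O ->
      smooth_pi_field O X -> smooth_pi_field O Y ->
      smooth_pi_field O Z -> smooth_pi_field O W ->
      forall u, O u ->
        vcov X v_curvature Y Z W u = lam u (X u) *: v_curvature Y Z W u.

Definition Sv_vanishes : Prop :=
  forall O X Y Z, slit_open O ->
    smooth_pi_field O X -> smooth_pi_field O Y -> smooth_pi_field O Z ->
    forall u, O u -> v_curvature X Y Z u = 0.

Definition Sv_recurrent2 : Prop :=
  exists Theta, pi_form2 Theta /\
    forall O X Y Z W U, slit_open O ->
      smooth_pi_field O X -> smooth_pi_field O Y ->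
      smooth_pi_field O Z -> smooth_pi_field O W -> smooth_pi_field O U ->
      forall u, O u ->
        vcov2 v_curvature Y X Z W U u =
        Theta u (X u) (Y u) *: v_curvature Z W U u.

End Connection.
End PiGeometry.

(* Main.v *)
Require Import Defs.
From mathcomp Require Import all_boot all_order all_algebra.
From mathcomp Require Import all_classical all_reals all_analysis.
From HB Require Import structures.
From mathcomp Require Import ring.
Set Implicit Arguments.
Unset Strict Implicit.
Unset Printing Implicit Defensive.
Import Order.TTheory GRing.Theory Num.Theory.
Import numFieldNormedType.Exports.
Local Open Scope classical_set_scope.
Local Open Scope ring_scope.

(** Only the vertical part of the Cartan connection matters, so everything
    happens inside a single slit tangent space T_pM \ {0}, read in the preferred
    chart at p, where a pi-vector field X restricts to the vector-valued map
    y |-> X (p, y).  There the connection is nabla_{gamma X} Y = D_X Y + C (X, Y)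
    with C bilinear ([nabla_vertical], [vchris]), and the metric g is the Hessian
    of L^2 / 2.  The symmetry of the mixed torsion T and nabla g = 0 force
    g (C (v, w), z) to be half the third derivative of L^2 / 2; hence C is
    symmetric, and because L^2 is homogeneous of degree 2, C (v, y) = 0 and C is
    homogeneous of degree -1 ([C_comm], [C_radial], [derive_C_radial]).  Three
    facts about the fundamental field eta follow:

    - nabla_{gamma X} eta = X ([cov_eta]);
    - the vertical torsion vanishes, so that [gamma X, gamma Y] is
      gamma (nabla_{gamma X} Y - nabla_{gamma Y} X) ([lie_bracket_gamma]);
    - S (eta, Y) Z = 0 ([curvature_eta]), the derivative of C along the ray
      cancelling the terms of order zero.

    Differentiating the last one, and using the first, gives
    (nabla_{gamma X} S) (eta, Y, Z) = - S (X, Y) Z ([vcov_curvature_eta]).  If S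
    is recurrent, the left-hand side is lambda (X) S (eta, Y) Z = 0, so S = 0.

    For recurrence of the second order one more ingredient is needed, the
    homogeneity nabla_{gamma eta} S = - 2 S ([vcov_eta_curvature]).  It is
    obtained without coordinates: S (eta, .) = 0 says that nabla_{gamma eta}
    commutes with the other vertical derivatives up to a term of order zero
    ([cov_eta_cov]), and moving it through the three terms of S produces - 2 S.
    Then the second vertical derivative of S, evaluated on (Y, eta, eta, W, U),
    is 3 S (Y, W) U ([vcov2_curvature_eta]), whereas recurrence makes it a
    multiple of S (eta, W) U = 0.  The converse implications hold with
    lambda = 0 and Theta = 0. *)

(** * Directional derivatives *)

Section Differentials.
Variables (R : realType).
Implicit Types (V W : normedModType R).

(** The difference of two maps that agree near x vanishes near x, hence is
    differentiable there. *)
Lemma differentiable_near V W (f g : V -> W) (x : V) :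
  (\near x, f x = g x) -> differentiable f x -> differentiable g x.
Proof.
move=> fg df.
pose h := g - f.
have h0 : \forall y \near x, h y = 0.
  near=> y; rewrite /h /= fctE; apply/eqP; rewrite subr_eq0 eq_sym.
  by apply/eqP; near: y.
have hE : h \o shift x = cst (h x) + (\0 : V -> W) +o_ 0 id.
  apply/eqaddoP => e e0.
  have h0' : \forall y \near (0 : V), h (y + x) = 0.
    by move: h0; rewrite (near_shift 0) /= => h0; near=> y; rewrite -[x]subr0; near: y.
  near=> y; rewrite /= !fctE /= (nbhs_singleton h0).
  rewrite /GRing.zero /= !add0r subr0 (_ : h (y + x) = 0) ?normr0 ?mulr_ge0 // ?ltW //.
  by near: y.
have dh : differentiable h x.
  apply/diff_locallyP.
  rewrite (@diff_unique _ _ _ h \0 x) //; last exact: cst_continuous.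
  by split => //; exact: cst_continuous.
have -> : g = f + h by apply/funext => y; rewrite /h !fctE addrC subrK.
exact: differentiableD.
Unshelve. all: by end_near. Qed.

Lemma derive_linear V W (f : V -> W) x (a : R) v w : differentiable f x ->
  'D_(a *: v + w) f x = a *: 'D_v f x + 'D_w f x.
Proof. by move=> df; rewrite !deriveE // linearP. Qed.

Lemma derive_chain V V' W (f : V -> V') (g : V' -> W) x v :
  differentiable f x -> differentiable g (f x) ->
  'D_v (fun y => g (f y)) x = 'D_('D_v f x) g (f x).
Proof.
move=> df dg; rewrite !deriveE //; last exact: (differentiable_comp df dg).
by rewrite (diff_comp df dg).
Qed.

Lemma differentiable_rowP V n (f : V -> 'rV[R]_n) x :
  (forall j, differentiable (fun y => f y 0 j) x) -> differentiable f x.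
Proof.
move=> df.
have -> : f = \sum_(j < n) (fun y => f y 0 j *: delta_mx 0 j).
  by apply/funext => y; rewrite fct_sumE -row_sum_delta.
apply: (@differentiable_sum _ _ _ _ (fun j y => f y 0 j *: delta_mx 0 j)) => j.
exact: (@differentiableZl _ _ _ (fun y => f y 0 j)).
Qed.

Lemma differentiable_coordE V n (f : V -> 'rV[R]_n) x j :
  differentiable f x -> differentiable (fun y => f y 0 j) x.
Proof.
move=> df.
exact: (differentiable_comp df (differentiable_coord _ _ _)).
Qed.

Lemma derive_coord V n (f : V -> 'rV[R]_n) x v j : derivable f x v ->
  ('D_v f x) 0 j = 'D_v (fun y => f y 0 j) x.
Proof. by move=> df; rewrite derive_mx // mxE. Qed.

Lemma derive_basis W n (f : 'rV[R]_n -> W) x v : differentiable f x ->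
  'D_v f x = \sum_k v 0 k *: 'D_(delta_mx 0 k) f x.
Proof.
move=> df; rewrite deriveE // {1}(row_sum_delta v) linear_sum.
by apply: eq_bigr => k _; rewrite linearZ deriveE.
Qed.

(** Both sides are the limit of one and the same difference quotient.  This
    reduces vertical derivatives on the tangent bundle to derivatives in a fibre. *)
Lemma derive_row W m n (f : 'rV[R]_(m + n) -> W) x y v :
  'D_(row_mx 0 v) f (row_mx x y) = 'D_v (fun z => f (row_mx x z)) y.
Proof.
rewrite /derive; set F := fun h : R => _; set G := fun h : R => _.
suff -> : F = G by [].
apply/funext => h; rewrite /F /G /=.
by rewrite scale_row_mx scaler0 add_row_mx add0r.
Qed.

(** A directional derivative is a total operator, whose value where the limit
    does not exist is the default point of the space of row vectors. *)
Lemma derive_nonderivable V n (f : V -> 'rV[R]_n) x v :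
  ~ derivable f x v -> 'D_v f x = 0.
Proof.
by move=> nf; rewrite /derive dvgP //; apply/rowP => j; rewrite !mxE.
Qed.

Lemma derive_row_mx V m n (c : 'rV[R]_m) (f : V -> 'rV[R]_n) x v :
  'D_v (fun y => row_mx c (f y)) x = row_mx 0 ('D_v f x).
Proof.
have eq : derivable f x v <->
    derivable (fun y => row_mx c (f y)) x v.
  split=> df; apply/derivable_mxP => i j.
    rewrite ord1; case: (split_ordP j) => k ->.
      rewrite (_ : (fun y => _) = cst (c 0 k)); first exact: derivable_cst.
      by apply/funext => y; rewrite row_mxEl.
    under eq_fun do rewrite row_mxEr.
    by move/derivable_mxP : df; apply.
  move/derivable_mxP : df => /(_ i (rshift m j)).
  by under eq_fun do rewrite row_mxEr.
have [df|ndf] := pselect (derivable f x v); last first.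
  rewrite !derive_nonderivable ?row_mx0 //.
  by apply: contra_not ndf => /eq.
apply/rowP => j; rewrite derive_coord; last exact/eq.
case: (split_ordP j) => k ->.
  rewrite row_mxEl mxE (_ : (fun y => _) = cst (c 0 k)) ?derive_cst //.
  by apply/funext => y; rewrite row_mxEl.
rewrite row_mxEr derive_coord //; congr ('D_v _ x).
by apply/funext => y; rewrite row_mxEr.
Qed.

(** Where the derivative exists it is computed coordinatewise, and elsewhere its
    value is 0.  This is applied to horizontal lifts, whose smoothness is then not
    at issue. *)
Lemma lsubmx_derive V m n (f : V -> 'rV[R]_(m + n)) x v :
  (forall j, 'D_v (fun y => lsubmx (f y) 0 j) x = 0) ->
  lsubmx ('D_v f x) = 0.
Proof.
move=> f0; have [df|ndf] := pselect (derivable f x v); last first.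
  by rewrite derive_nonderivable // linear0.
apply/rowP => j; rewrite !mxE derive_coord // -(f0 j).
by congr ('D_v _ x); apply/funext => y; rewrite !mxE.
Qed.

Lemma deriveZ_row V n (a : V -> R) (F : V -> 'rV[R]_n) x v :
  differentiable a x -> differentiable F x ->
  'D_v (fun y => a y *: F y) x = 'D_v a x *: F x + a x *: 'D_v F x.
Proof.
move=> da dF.
have dFj j : derivable (fun y => F y 0 j) x v.
  exact/diff_derivable/differentiable_coordE.
apply/rowP => j; rewrite derive_coord; last first.
  apply/diff_derivable/differentiable_rowP => k.
  under eq_fun do rewrite mxE.
  exact/differentiableM/differentiable_coordE.
under eq_fun do rewrite mxE.
rewrite (@deriveM _ _ a (fun y => F y 0 j)) //; last exact/diff_derivable.
rewrite [RHS]mxE [X in _ = X + _]mxE [X in _ = _ + X]mxE.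
by rewrite (derive_coord j (diff_derivable dF)) [X in X + _]/GRing.scale /= addrC
  [F x 0 j *: _]mulrC.
Qed.
End Differentials.

(** * Closure properties of C^k maps *)

Section Smoothness.
Variable R : realType.
Implicit Types (V W : normedModType R).

Lemma open_near_eq V W (O : set V) (f g : V -> W) : open O ->
  (forall x, O x -> f x = g x) -> forall x, O x -> \near x, f x = g x.
Proof.
move=> oO fg x Ox.
by apply: filterS (open_nbhs_nbhs (conj oO Ox)) => y; exact: fg.
Qed.

Lemma Ck_eq V W k (O : set V) (f g : V -> W) : open O ->
  (forall x, O x -> f x = g x) -> Ck k O f -> Ck k O g.
Proof.
move=> oO; elim: k f g => [|k IH] f g fg /=.
  move=> cf x Ox; rewrite /prop_for /continuous_at -fg //.
  apply: cvg_trans (cf x Ox); apply: near_eq_cvg.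
  exact: open_near_eq Ox.
move=> [df dv]; split=> [x Ox|v].
  exact: differentiable_near (open_near_eq oO fg Ox) (df x Ox).
apply: IH (dv v) => x Ox.
exact: near_eq_derive (open_near_eq oO fg Ox).
Qed.

Lemma Ck_subset V W k (O O' : set V) (f : V -> W) : O' `<=` O ->
  Ck k O f -> Ck k O' f.
Proof.
move=> sO; elim: k f => [|k IH] f /=; first by move=> cf x /sO; exact: cf.
by move=> [df dv]; split=> [x /sO|v]; [exact: df|exact: IH].
Qed.

Lemma CkW V W k (O : set V) (f : V -> W) : Ck k.+1 O f -> Ck k O f.
Proof.
elim: k f => [|k IH] f /=; first by move=> [df _] x /df /differentiable_continuous.
by move=> [df dv]; split => // v; apply: IH.
Qed.

Lemma Ck_cst V W k (O : set V) (a : W) : Ck k O (fun=> a).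
Proof.
elim: k a => [|k IH] a /=; first by move=> x _; exact: cst_continuous.
split=> [x _|v]; first exact: differentiable_cst.
have -> : 'D_v (fun=> a) = (fun=> 0) by apply/funext => x; rewrite derive_cst.
exact: IH.
Qed.

Lemma Ck_linear V W k (O : set V) (f : {linear V -> W}) : continuous f ->
  Ck k O f.
Proof.
move=> cf; case: k => [|k] /=; first by move=> x _; exact: cf.
split=> [x _|v]; first exact: linear_differentiable.
have -> : 'D_v f = (fun=> f v).
  apply/funext => x; rewrite deriveE; last exact: linear_differentiable.
  by rewrite diff_lin.
exact: Ck_cst.
Qed.

Lemma Ck_add V W k (O : set V) (f g : V -> W) : open O ->
  Ck k O f -> Ck k O g -> Ck k O (fun x => f x + g x).
Proof.
move=> oO; elim: k f g => [|k IH] f g /=.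
  by move=> cf cg x Ox; apply: continuousD; [exact: cf|exact: cg].
move=> [df dvf] [dg dvg]; split=> [x Ox|v].
  by apply: differentiableD; [exact: df|exact: dg].
apply: (@Ck_eq _ _ _ _ (fun x => 'D_v f x + 'D_v g x)) => // [x Ox|].
  by rewrite [RHS]deriveD //; apply: diff_derivable; [exact: df|exact: dg].
exact: IH.
Qed.

Lemma Ck_mul V k (O : set V) (f g : V -> R) : open O ->
  Ck k O f -> Ck k O g -> Ck k O (fun x => f x * g x).
Proof.
move=> oO; elim: k f g => [|k IH] f g.
  by move=> cf cg x Ox; apply: continuousM; [exact: cf|exact: cg].
move=> Cf Cg; move: (CkW Cf) (CkW Cg) => Cf' Cg'.
move: Cf Cg => [df dvf] [dg dvg]; split=> [x Ox|v].
  by apply: differentiableM; [exact: df|exact: dg].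
apply: (@Ck_eq _ _ _ _ (fun x => f x * 'D_v g x + g x * 'D_v f x)) => //.
  move=> x Ox.
  by rewrite [RHS]deriveM //; apply: diff_derivable; [exact: df|exact: dg].
apply: Ck_add => //; [exact: IH Cf' (dvg v)|exact: IH Cg' (dvf v)].
Qed.

Lemma Ck_sum V W k (O : set V) n (f : 'I_n -> V -> W) : open O ->
  (forall i, Ck k O (f i)) -> Ck k O (fun x => \sum_i f i x).
Proof.
move=> oO Cf; rewrite -fct_sumE.
by elim/big_ind: _ => [|g h|i _]; [exact: Ck_cst|exact: Ck_add|exact: Cf].
Qed.

Lemma continuous_coordP V n (f : V -> 'rV[R]_n) x :
  {for x, continuous f} <-> forall j, {for x, continuous (fun y => f y 0 j)}.
Proof.
split=> [cf j|cf].
  exact: (continuous_comp cf (@coord_continuous _ _ _ _ _ _)).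
have -> : f = fun y => \sum_(j < n) f y 0 j *: delta_mx 0 j.
  by apply/funext => y; rewrite -row_sum_delta.
rewrite -fct_sumE.
elim/big_ind: _ => [|g h cg ch|j _]; first exact: cst_continuous.
  exact: continuousD.
by apply: cvgZr_tmp; exact: cf.
Qed.

Lemma Ck_coordP V k n (O : set V) (f : V -> 'rV[R]_n) : open O ->
  Ck k O f <-> forall j, Ck k O (fun x => f x 0 j).
Proof.
move=> oO; elim: k f => [|k IH] f /=.
  split=> [cf j x Ox|cf x Ox]; first exact: (continuous_coordP _ _).1 (cf x Ox) j.
  by apply/continuous_coordP => j; exact: cf.
split=> [[df dv] j|H].
  split=> [x /df|v]; first exact: differentiable_coordE.
  apply: (@Ck_eq _ _ _ _ (fun x => 'D_v f x 0 j)) => //.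
    by move=> x /df df'; rewrite derive_coord //; exact: diff_derivable.
  exact: (IH _).1 (dv v) j.
have df x : O x -> differentiable f x.
  by move=> Ox; apply: differentiable_rowP => j; apply: (H j).1.
split=> // v; apply: (IH _).2 => j.
apply: Ck_eq ((H j).2 v) => // x /df df'.
by rewrite derive_coord //; exact: diff_derivable.
Qed.

(** Induction on k: the derivative of the composite is a sum of products of
    the partial derivatives of f, composed with g, and of the coordinates of the
    derivative of g. *)
Lemma Ck_comp_scalar V k n (O : set V) (O' : set 'rV[R]_n) (g : V -> 'rV[R]_n)
    (f : 'rV[R]_n -> R) : open O -> open O' -> (forall x, O x -> O' (g x)) ->
  Ck k O g -> Ck k O' f -> Ck k O (fun x => f (g x)).
Proof.
move=> oO oO' gO; elim: k f => [|k IH] f.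
  move=> cg cf x Ox; apply: continuous_comp; first exact: cg.
  exact/cf/gO.
move=> Cg Cf; have Cg' := CkW Cg; move: Cg Cf => [dg dvg] [df dvf].
split=> [x Ox|v].
  exact: (differentiable_comp (dg _ Ox) (df _ (gO _ Ox))).
apply: (@Ck_eq _ _ _ _
    (fun x => \sum_j ('D_v g x) 0 j * 'D_(delta_mx 0 j) f (g x))) => //.
  move=> x Ox; rewrite (derive_chain _ (dg _ Ox) (df _ (gO _ Ox))).
  by rewrite [RHS]derive_basis //; exact/df/gO.
apply: Ck_sum => // j; apply: Ck_mul => //.
  by move/Ck_coordP : (dvg v); apply.
exact: (IH _ Cg' (dvf _)).
Qed.

Lemma Ck_comp V k m n (O : set V) (O' : set 'rV[R]_n) (g : V -> 'rV[R]_n)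
    (f : 'rV[R]_n -> 'rV[R]_m) : open O -> open O' ->
  (forall x, O x -> O' (g x)) ->
  Ck k O g -> Ck k O' f -> Ck k O (fun x => f (g x)).
Proof.
move=> oO oO' gO Cg Cf; apply/Ck_coordP => // j.
apply: (@Ck_comp_scalar _ _ _ _ _ g (fun y => f y 0 j) oO oO' gO Cg).
by move/Ck_coordP : Cf; apply.
Qed.

End Smoothness.

Section MoreSmooth.
Variable R : realType.
Implicit Types (V W : normedModType R).

(** The differential of a transition map, applied to a moving vector at a
    moving point: the form that coordinate changes of sections take. *)
Lemma Ck_pushforward V k m n (O : set V) (U : set 'rV[R]_n)
    (phi : 'rV[R]_n -> 'rV[R]_m) (g F : V -> 'rV[R]_n) :
  open O -> open U -> (forall x, O x -> U (g x)) ->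
  Ck k O g -> Ck k O F -> Ck k.+1 U phi ->
  Ck k O (fun z => 'D_(F z) phi (g z)).
Proof.
move=> oO oU gU Cg CF [dphi dvphi].
apply/Ck_coordP => // j.
apply: (@Ck_eq _ _ _ _ _
   (fun z => \sum_i F z 0 i * ('D_(delta_mx 0 i) phi (g z)) 0 j)) => //.
  move=> x Ox; rewrite (derive_basis _ (dphi _ (gU _ Ox))) summxE.
  by apply: eq_bigr => i _; rewrite mxE.
apply: Ck_sum => // i; apply: Ck_mul => //.
  exact: (Ck_coordP _ _ oO).1 CF i.
apply: (Ck_coordP _ _ oO).1 _ j.
exact: (Ck_comp oO oU gU Cg (dvphi _)).
Qed.

Lemma Ck_row_mx V k m n (O : set V) (f : V -> 'rV[R]_m) (g : V -> 'rV[R]_n) :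
  open O -> Ck k O f -> Ck k O g -> Ck k O (fun x => row_mx (f x) (g x)).
Proof.
move=> oO Cf Cg; apply/Ck_coordP => // j; case: (split_ordP j) => i ->.
  by under eq_fun do rewrite row_mxEl; apply: (Ck_coordP _ _ oO).1 Cf i.
by under eq_fun do rewrite row_mxEr; apply: (Ck_coordP _ _ oO).1 Cg i.
Qed.

Lemma Ck_lsubmx k m n (O : set 'rV[R]_(m + n)) : Ck k O lsubmx.
Proof. by apply: Ck_linear; exact: continuous_lsubmx. Qed.

Lemma Ck_rsubmx k m n (O : set 'rV[R]_(m + n)) : Ck k O rsubmx.
Proof. by apply: Ck_linear; exact: continuous_rsubmx. Qed.

Lemma open_neq0 V : open [set y : V | y != 0].
Proof.
rewrite (_ : mkset _ = ~` [set 0]).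
  apply: closed_openC; apply: accessible_closed_set1.
  exact: hausdorff_accessible (@norm_hausdorff _ _).
by apply/seteqP; split => y /=; [move/eqP|move=> ?; apply/eqP].
Qed.

Lemma Ck_id V k (O : set V) : Ck k O id.
Proof. by apply: (@Ck_linear _ _ _ _ _ idfun) => x; exact: cvg_id. Qed.

Lemma Ck_row_cst k m n (O : set 'rV[R]_n) (c : 'rV[R]_m) : open O ->
  Ck k O (row_mx c).
Proof. by move=> oO; apply: Ck_row_mx => //; [exact: Ck_cst|exact: Ck_id]. Qed.

Lemma continuous_row_cst m n (c : 'rV[R]_m) :
  continuous (row_mx c : 'rV[R]_n -> 'rV[R]_(m + n)).
Proof. by move=> x; exact: (@Ck_row_cst 0 m n setT c openT x I). Qed.

(** The map v |-> D_v f x is linear, so it is its own differential. *)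
Lemma derive_derive_dir V W (f : V -> W) x y w : differentiable f x ->
  'D_w (fun v => 'D_v f x) y = 'D_w f x.
Proof.
move=> df; rewrite (_ : (fun v => 'D_v f x) = 'd f x); last first.
  by apply/funext => v; rewrite deriveE.
rewrite deriveE; last exact/linear_differentiable/diff_continuous.
by rewrite diff_lin ?deriveE //; exact: diff_continuous.
Qed.

Lemma derive_linear_map V W (f : {linear V -> W}) x v : continuous f ->
  'D_v f x = f v.
Proof.
by move=> cf; rewrite deriveE ?diff_lin //; exact: linear_differentiable.
Qed.

End MoreSmooth.

(** * Symmetry of second derivatives *)

Section Schwarz.
Variable R : realType.
Implicit Types (V W : normedModType R).

(** The two difference quotients coincide. *)
Lemma is_derive_line V W (f : V -> W) (a v : V) (s : R) :
  derivable f (s *: v + a) v ->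
  is_derive s 1 (fun s : R => f (s *: v + a)) ('D_v f (s *: v + a)).
Proof.
move=> df.
suff E : (fun h : R => h^-1 *: (((fun s => f (s *: v + a)) \o shift s) (h *: 1)
    - f (s *: v + a))) =
  (fun h => h^-1 *: ((f \o shift (s *: v + a)) (h *: v) - f (s *: v + a))).
  by split; rewrite ?/derivable ?/derive E.
by apply/funext => h /=; rewrite [h *: 1]mulr1 scalerDl addrA.
Qed.

(** Two applications of the mean value theorem, first along v and then along
    w.  The left-hand side is symmetric in v and w, which is what yields the
    symmetry of second derivatives. *)
Lemma mixed_difference V (O U : set V) (f : V -> R) x v w :
  open O -> Ck 2 O f -> O x -> nbhs x U ->
  exists2 d : R, 0 < d & forall h, 0 < h < d -> exists2 p, U p &
    f (h *: v + (h *: w + x)) - f (h *: v + x) - (f (h *: w + x) - f x)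
    = h ^+ 2 * 'D_w ('D_v f) p.
Proof.
move=> oO [df dvf] Ox Ux.
have /nbhs_ballP[r /= r0 rU] : nbhs x (O `&` U).
  by apply: filterI => //; exact: open_nbhs_nbhs.
have N0 : 0 < `|v| + `|w| + 1 by rewrite ltr_wpDl // addr_ge0.
exists (r / (`|v| + `|w| + 1)); first exact: divr_gt0.
move=> h /andP[h0]; rewrite ltr_pdivlMr // => hr.
have inU s t : 0 <= s <= h -> 0 <= t <= h -> (O `&` U) (s *: v + (t *: w + x)).
  move=> /andP[s0 sh] /andP[t0 th]; apply: rU.
  rewrite -ball_normE /= addrA [_ + x]addrC opprD addNKr normrN.
  apply: le_lt_trans (ler_normD _ _) _.
  rewrite !normrZ !ger0_norm //; apply: le_lt_trans hr.
  rewrite !mulrDr mulr1 (@le_trans _ _ (h * `|v| + h * `|w|)) //.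
    by rewrite lerD // ler_wpM2r.
  by rewrite lerDl ltW.
have h0' : 0 <= (0 : R) <= h by rewrite lexx ltW.
have hh : 0 <= h <= h by rewrite lexx ltW.
pose u (s : R) := f (s *: v + (h *: w + x)) - f (s *: v + x).
have itvW s : s \in `]0, h[ -> 0 <= s <= h.
  by rewrite in_itv /= => /andP[? ?]; rewrite !ltW.
have itvW' s : s \in `[0, h] -> 0 <= s <= h by rewrite in_itv.
have du s : 0 <= s <= h -> is_derive s 1 u
    ('D_v f (s *: v + (h *: w + x)) - 'D_v f (s *: v + x)).
  move=> sh; apply: is_deriveB; apply: is_derive_line; apply: diff_derivable.
    exact/df/(inU _ _ sh hh).1.
  by apply: df; have := (inU _ _ sh h0').1; rewrite scale0r add0r.
have cu : {within `[0, h], continuous u}.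
  by apply: derivable_within_continuous => s /itvW' /du [].
have [s s0h us] := MVT h0 (fun s sh => du s (itvW s sh)) cu.
have sh := itvW _ s0h.
have [dvfd _] := dvf v.
pose g (t : R) := 'D_v f (t *: w + (s *: v + x)).
have dg t : 0 <= t <= h ->
    is_derive t 1 g ('D_w ('D_v f) (t *: w + (s *: v + x))).
  move=> th; apply: is_derive_line; apply: diff_derivable; apply: dvfd.
  by rewrite addrCA; exact: (inU _ _ sh th).1.
have cg : {within `[0, h], continuous g}.
  by apply: derivable_within_continuous => t /itvW' /dg [].
have [t t0h ut] := MVT h0 (fun t th => dg t (itvW t th)) cg.
exists (t *: w + (s *: v + x)).
  by rewrite addrCA; exact: (inU _ _ sh (itvW _ t0h)).2.
move: us ut; rewrite /u /g !scale0r !add0r subr0 [h *: w + (s *: v + x)]addrCA.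
by move=> -> ->; rewrite expr2 -mulrA mulrC.
Qed.

Lemma ler_dist_split (a b c c' e : R) :
  `|a - c| < e / 2 -> `|b - c'| < e / 2 -> c = c' -> `|a - b| <= e.
Proof.
move=> ac bc cc'; rewrite -(subrKA c) (le_trans (ler_normD _ _)) //.
by rewrite [e]splitr lerD // ltW // distrC cc'.
Qed.

Lemma schwarz_scalar V (O : set V) (f : V -> R) x v w :
  open O -> Ck 2 O f -> O x -> 'D_w ('D_v f) x = 'D_v ('D_w f) x.
Proof.
move=> oO Cf Ox; apply/eqP; rewrite -subr_eq0 -normr_le0.
apply/ler_addgt0Pr => e e0; rewrite add0r.
pose U a b := [set p | `|'D_a ('D_b f) x - 'D_a ('D_b f) p| < e / 2].
have nU a b : nbhs x (U a b).
  have e2 : 0 < e / 2 by rewrite divr_gt0.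
  have [_ /(_ b)[_ /(_ a) /= cf]] := Cf.
  by have /cvgrPdist_lt := cf _ Ox; apply.
(* both mixed derivatives, taken at points p and q where they differ from their
   values at x by less than e / 2, equal the same second difference over h ^+ 2 *)
have [d d0 dP] := mixed_difference v w oO Cf Ox (nU w v).
have [d' d'0 dP'] := mixed_difference w v oO Cf Ox (nU v w).
pose h := Num.min d d' / 2.
have m0 : 0 < Num.min d d' by rewrite lt_min d0.
have h0 : 0 < h by rewrite divr_gt0.
have hm : h < Num.min d d' by rewrite /h gtr_pMr // invf_lt1 // ltr1n.
have /andP[hd hd'] : (h < d) && (h < d') by rewrite -lt_min.
have [|p Up ep] := dP h; first by rewrite h0.
have [|q Uq eq] := dP' h; first by rewrite h0.
have pq : 'D_w ('D_v f) p = 'D_v ('D_w f) q.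
  apply: (mulfI (_ : h ^+ 2 != 0)); first by rewrite expf_neq0 // gt_eqF.
  apply: etrans (esym ep) _; apply: etrans _ eq.
  by rewrite [X in f X - _]addrCA !opprB [in LHS](addrC (f x)) addrACA
    [- f (h *: v + x) + f x]addrC.
exact: ler_dist_split Up Uq pq.
Qed.

Lemma schwarz V n (O : set V) (f : V -> 'rV[R]_n) x v w :
  open O -> Ck 2 O f -> O x -> 'D_w ('D_v f) x = 'D_v ('D_w f) x.
Proof.
move=> oO Cf Ox; apply/rowP => j.
have coord a b : ('D_a ('D_b f) x) 0 j = 'D_a ('D_b (fun y => f y 0 j)) x.
  have [df dvf] := Cf; have [dbf _] := dvf b.
  rewrite derive_coord; last exact/diff_derivable/dbf.
  apply: near_eq_derive; apply: (open_near_eq oO) Ox => y Oy.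
  by rewrite derive_coord //; exact/diff_derivable/df.
have Cj : Ck 2 O (fun y => f y 0 j) by exact: (Ck_coordP _ _ oO).1 Cf j.
exact: etrans (coord w v) (etrans (schwarz_scalar v w oO Cj Ox)
  (esym (coord v w))).
Qed.

End Schwarz.

(** * Hessian metrics of functions homogeneous of degree two *)

Section Homogeneity.
Variable R : realType.
Implicit Types V W : normedModType R.

(** In the applications c is a power of t: a derivative lowers the degree of
    homogeneity by one. *)
Lemma derive_homogeneous V (O : set V) (F : V -> R) (t c : R) x v :
  open O -> 0 < t -> O x -> O (t *: x) ->
  (forall y, O y -> F (t *: y) = c * F y) ->
  (forall y, O y -> differentiable F y) ->
  'D_v F (t *: x) = c / t * 'D_v F x.
Proof.
move=> oO t0 Ox Otx hF dF.
have dt : differentiable (fun y : V => t *: y) x by exact: differentiableZ.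
have tv : 'D_v (fun y : V => t *: y) x = t *: v.
  by rewrite [LHS]deriveZ ?derive_id //; exact: derivable_id.
have E : 'D_(t *: v) F (t *: x) = c * 'D_v F x.
  rewrite -{1}tv -(derive_chain v dt (dF _ Otx)).
  rewrite (near_eq_derive v (open_near_eq oO hF Ox)).
  by rewrite [LHS](@deriveZ _ _ _ F c x v (diff_derivable (dF _ Ox))).
have tE : 'D_(t *: v) F (t *: x) = t * 'D_v F (t *: x).
  by rewrite !(deriveE _ (dF _ Otx)) linearZ.
by rewrite mulrAC -E tE mulrAC mulfV ?mul1r // gt_eqF.
Qed.

(** Euler's relation: restrict F to the ray through x and differentiate e at 1. *)
Lemma derive_euler V W (F : V -> W) (e : R -> R) x :
  derivable F x x -> derivable e 1 1 ->
  (forall s, 0 < s -> F (s *: x) = e s *: F x) ->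
  'D_x F x = ('D_1 e 1) *: F x.
Proof.
move=> dF de hF.
have dF' : derivable F (1 *: x + 0) x by rewrite scale1r addr0.
have [_] := is_derive_line dF'; rewrite scale1r addr0 => <-.
have nF : \forall s \near (1 : R), F (s *: x + 0) = e s *: F x.
  have := open_nbhs_nbhs (conj (@open_gt _ (0 : R)) (@ltr01 R)).
  by apply: filterS => s /= s0; rewrite addr0 hF.
have de' : differentiable e (1 : R) by apply/derivable1_diffP.
rewrite (near_eq_derive _ nF) deriveE; last exact: differentiableZl.
by rewrite diffZl // deriveE.
Qed.

End Homogeneity.

Section HessianMetric.
Variables (R : realType) (n : nat) (f : 'rV[R]_n -> R).
Local Notation V := 'rV[R]_n.
Local Notation O := [set y : V | y != 0].
Hypothesis oO : open O.
Hypothesis Cf : forall k, Ck k O f.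
Hypothesis f_homogeneous : forall (t : R) y, 0 < t -> y != 0 ->
  f (t *: y) = t ^+ 2 * f y.

(** Twice the fundamental tensor when f is the square of a Finsler metric. *)
Definition hessian (y v w : V) : R := 'D_v ('D_w f) y.
Hypothesis hessian_posdef : forall y v, y != 0 -> v != 0 -> 0 < hessian y v v.

Variable C : V -> V -> V -> V.
Hypothesis C_sym : forall y v w z, y != 0 ->
  hessian y (C y v w) z = hessian y (C y v z) w.
Hypothesis C_metric : forall y v w z, y != 0 ->
  'D_v (fun y => hessian y w z) y = hessian y (C y v w) z + hessian y w (C y v z).
Hypothesis C_diff : forall y v w, y != 0 -> differentiable (fun y => C y v w) y.

Let CDf w k : Ck k O ('D_w f). Proof. by have [_] := Cf k.+1; apply. Qed.
Let CDDf v w k : Ck k O ('D_v ('D_w f)).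
Proof. by have [_] := CDf w k.+1; apply. Qed.
Let df y : O y -> differentiable f y. Proof. exact: (Cf 1).1. Qed.
Let dDf w y : O y -> differentiable ('D_w f) y. Proof. exact: (CDf w 1).1. Qed.
Let dDDf v w y : O y -> differentiable ('D_v ('D_w f)) y.
Proof. exact: (CDDf v w 1).1. Qed.

Lemma hessianC y v w : y != 0 -> hessian y v w = hessian y w v.
Proof. exact: schwarz_scalar (Cf 2). Qed.

Lemma hessian_linear y a v w z : y != 0 ->
  hessian y (a *: v + w) z = a * hessian y v z + hessian y w z.
Proof. by move=> y0; rewrite /hessian derive_linear //; exact: dDf. Qed.

Lemma hessian_inj y v w : y != 0 ->
  (forall z, hessian y v z = hessian y w z) -> v = w.
Proof.
move=> y0 vw; apply/eqP; rewrite -subr_eq0; apply/negP => /negP vw0.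
have := hessian_posdef y0 vw0.
rewrite -{1}[v - w]addrC -scaleN1r hessian_linear // vw mulN1r addNr ltxx //.
Qed.

Let homD w t y : 0 < t -> O y -> 'D_w f (t *: y) = t * 'D_w f y.
Proof.
move=> t0 y0; rewrite (derive_homogeneous (c := t ^+ 2) (O := O)) //.
- by rewrite expr2 mulfK // gt_eqF.
- by rewrite /= scaler_eq0 negb_or gt_eqF.
- by move=> z; exact: f_homogeneous.
Qed.

Let homDD v w t y : 0 < t -> O y -> hessian (t *: y) v w = hessian y v w.
Proof.
move=> t0 y0; rewrite /hessian (derive_homogeneous (c := t) (O := O)) //.
- by rewrite mulfV ?mul1r // gt_eqF.
- by rewrite /= scaler_eq0 negb_or gt_eqF.
- by move=> z; exact: homD.
- by move=> z; exact: dDf.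
Qed.

Let homDDD u v w t y : 0 < t -> O y ->
  'D_u (fun y => hessian y v w) (t *: y) = t^-1 * 'D_u (fun y => hessian y v w) y.
Proof.
move=> t0 y0; rewrite (derive_homogeneous (c := 1) (O := O)) ?mul1r //.
- by rewrite /= scaler_eq0 negb_or gt_eqF.
- by move=> z z0; rewrite mul1r; exact: homDD.
- by move=> z; exact: dDDf.
Qed.

(** C is determined as for the Levi-Civita connection: the two terms of the
    metric condition are equal, as C (v, .) is self-adjoint for the Hessian. *)
Lemma hessian_C y v w z : y != 0 ->
  hessian y (C y v w) z = 2^-1 * 'D_v (fun y => hessian y w z) y.
Proof.
move=> y0; rewrite C_metric // [hessian y w _]hessianC // -(C_sym _ w) //.
by rewrite -mulr2n -[X in _ * X]mulr_natl mulKf ?pnatr_eq0.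
Qed.

Lemma derive_hessianC y v w z : y != 0 ->
  'D_v (fun y => hessian y w z) y = 'D_w (fun y => hessian y v z) y.
Proof. by move=> y0; apply: (@schwarz_scalar _ _ O ('D_z f)) => //; exact: CDf. Qed.

Lemma derive_hessian_radial y v w : y != 0 ->
  'D_y (fun y => hessian y v w) y = 0.
Proof.
move=> y0; rewrite (@derive_euler _ _ _ _ (fun=> 1)).
- by rewrite derive_cst scale0r.
- exact/diff_derivable/dDDf.
- exact: derivable_cst.
- by move=> s s0; rewrite homDD // scale1r.
Qed.

(** The third derivative of f is symmetric and the Hessian is nondegenerate. *)
Lemma C_comm y v w : y != 0 -> C y v w = C y w v.
Proof.
move=> y0; apply: (hessian_inj y0) => z.
exact: etrans (@hessian_C y v w z y0) (etrans
  (congr1 ( *%R 2^-1) (@derive_hessianC y v w z y0))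
  (esym (@hessian_C y w v z y0))).
Qed.

Lemma hessian0l y z : y != 0 -> hessian y 0 z = 0.
Proof. by move=> _; exact: derive0. Qed.

(** By the symmetry of third derivatives the direction y can be moved to the
    front, and the Hessian is constant along rays. *)
Lemma C_radial y v : y != 0 -> C y v y = 0.
Proof.
move=> y0; apply: (hessian_inj y0) => z.
apply: etrans (@hessian_C y v y z y0) _; rewrite hessian0l //.
apply: etrans (congr1 _ (@derive_hessianC y v y z y0)) _.
by rewrite (@derive_hessian_radial y v z y0) mulr0.
Qed.

(** The Hessian has degree 0 and its derivatives have degree -1. *)
Lemma C_homogeneous y v w t : y != 0 -> 0 < t ->
  C (t *: y) v w = t^-1 *: C y v w.
Proof.
move=> y0 t0; apply: (hessian_inj y0) => z.
have ty0 : t *: y != 0 by rewrite scaler_eq0 negb_or gt_eqF.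
rewrite -[t^-1 *: _]addr0 hessian_linear // hessian0l // addr0.
rewrite -[LHS](homDD _ _ t0 y0).
apply: etrans (@hessian_C (t *: y) v w z ty0) _.
rewrite (homDDD v w z t0 y0) mulrCA.
by rewrite (@hessian_C y v w z y0).
Qed.

Lemma derive_C_radial y v w : y != 0 ->
  'D_y (fun y => C y v w) y = - C y v w.
Proof.
move=> y0; rewrite (@derive_euler _ _ _ _ (fun s => s^-1)).
- rewrite [X in X *: _](@deriveV _ _ id) ?oner_neq0 //.
  by rewrite derive_id expr1n invr1 [(- 1) *: 1]mulr1 scaleN1r.
- exact/diff_derivable/C_diff.
- by apply: (@derivableV _ _ id); [exact: oner_neq0|exact: derivable_id].
- by move=> s s0; rewrite C_homogeneous.
Qed.

End HessianMetric.

(** * Derivatives of fields of linear and bilinear maps *)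

Section LinearField.
Variable R : realType.

Lemma linear_expand m n (B : 'rV[R]_m -> 'rV[R]_n) v :
  (forall a v w, B (a *: v + w) = a *: B v + B w) ->
  B v = \sum_k v 0 k *: B (delta_mx 0 k).
Proof.
move=> linB.
pose Bl : {linear 'rV[R]_m -> 'rV[R]_n} :=
  HB.pack B (GRing.isLinear.Build _ _ _ _ _ linB).
rewrite -[B]/(Bl : _ -> _) {1}(row_sum_delta v) linear_sum.
by apply: eq_bigr => k _; rewrite linearZ.
Qed.

Section Product.
Variables (U : normedModType R) (m n : nat) (F : set U).
Variables (B : U -> 'rV[R]_m -> 'rV[R]_n) (Y : U -> 'rV[R]_m) (x : U).
Hypotheses (oF : open F) (Fx : F x).
Hypothesis linB : forall y, F y ->
  forall a v w, B y (a *: v + w) = a *: B y v + B y w.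
Hypothesis diffB : forall v, differentiable (fun y => B y v) x.
Hypothesis diffY : differentiable Y x.

Let G k (y : U) := Y y 0 k *: B y (delta_mx 0 k).

Let dG k : differentiable (G k) x.
Proof.
apply: differentiable_rowP => j.
rewrite (_ : (fun y => _) = (fun y => Y y 0 k * B y (delta_mx 0 k) 0 j)).
  by apply: differentiableM; exact: differentiable_coordE.
by apply/funext => y; rewrite mxE.
Qed.

Let nearG : \forall y \near x, (\sum_k G k) y = B y (Y y).
Proof.
apply: (open_near_eq oF) Fx => y Fy.
by rewrite fct_sumE [RHS]linear_expand //; exact: linB.
Qed.

Lemma differentiable_linear_field : differentiable (fun y => B y (Y y)) x.
Proof.
by apply: differentiable_near nearG _; apply: differentiable_sum.
Qed.

(** Leibniz rule for a field B of linear maps applied to a field Y of vectors,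
    obtained by expanding Y in the canonical basis. *)
Lemma derive_linear_field h :
  'D_h (fun y => B y (Y y)) x = 'D_h (fun y => B y (Y x)) x + B x ('D_h Y x).
Proof.
rewrite -(near_eq_derive h nearG) derive_sum; last first.
  by move=> k; exact: diff_derivable.
have -> : 'D_h (fun y => B y (Y x)) x =
    \sum_k Y x 0 k *: 'D_h (fun y => B y (delta_mx 0 k)) x.
  have nB : \forall y \near x,
      (\sum_k (fun y => Y x 0 k *: B y (delta_mx 0 k))) y = B y (Y x).
    apply: (open_near_eq oF) Fx => y Fy.
    by rewrite fct_sumE [RHS]linear_expand //; exact: linB.
  rewrite -(near_eq_derive h nB) derive_sum; last first.
    by move=> k; apply: derivableZ; exact: diff_derivable.
  by apply: eq_bigr => k _; apply: deriveZ; exact: diff_derivable.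
rewrite [B x _]linear_expand; last exact: linB.
rewrite -big_split; apply: eq_bigr => k _ /=.
rewrite (deriveZ_row _ (differentiable_coordE k diffY) (diffB _)) addrC.
by rewrite (derive_coord k (diff_derivable diffY)).
Qed.
End Product.

Lemma derive_bilinear_field (U : normedModType R) l m n (F : set U)
    (B : U -> 'rV[R]_l -> 'rV[R]_m -> 'rV[R]_n) Y Z x h :
  open F -> F x ->
  (forall y w, F y -> forall a v v', B y (a *: v + v') w = a *: B y v w + B y v' w) ->
  (forall y v, F y -> forall a w w', B y v (a *: w + w') = a *: B y v w + B y v w') ->
  (forall v w, differentiable (fun y => B y v w) x) ->
  differentiable Y x -> differentiable Z x ->
  'D_h (fun y => B y (Y y) (Z y)) x =
  'D_h (fun y => B y (Y x) (Z x)) x + B x ('D_h Y x) (Z x) + B x (Y x) ('D_h Z x).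
Proof.
move=> oF Fx linl linr dB dY dZ.
have dBY w : differentiable (fun y => B y (Y y) w) x.
  apply: (@differentiable_linear_field _ _ _ F (fun y v => B y v w)) => //.
  by move=> y Fy; exact: linl.
apply: etrans (@derive_linear_field _ _ _ F (fun y w => B y (Y y) w) Z x
  oF Fx _ dBY dZ h) _; first by move=> y Fy; exact: linr.
congr (_ + _).
apply: (@derive_linear_field _ _ _ F (fun y v => B y v (Z x)) Y x oF Fx _ _ dY h).
  by move=> y Fy; exact: linl.
by move=> v; exact: dB.
Qed.

(** The Leibniz rule for the field of linear maps v |-> D_v Z y. *)
Lemma derive_derive_field m n (F : set 'rV[R]_m) (Y : 'rV[R]_m -> 'rV[R]_m)
    (Z : 'rV[R]_m -> 'rV[R]_n) x h :
  open F -> F x -> Ck 2 F Z -> differentiable Y x ->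
  'D_h (fun y => 'D_(Y y) Z y) x = 'D_h ('D_(Y x) Z) x + 'D_('D_h Y x) Z x.
Proof.
move=> oF Fx [dZ dvZ] dY.
apply: (@derive_linear_field _ _ _ F (fun y v => 'D_v Z y) Y x oF Fx _ _ dY h).
  by move=> y Fy a v w; apply: derive_linear; exact: dZ.
by move=> v; exact: (dvZ v).1 x Fx.
Qed.

End LinearField.

(** * Charts of the tangent bundle *)

Section Manifold.
Variables (R : realType) (n : nat) (M : topologicalType).
Variables (A : chartedSpace R n M) (hM : smooth_manifold A).
Local Notation TM := (M * 'rV[R]_n)%type.
Local Notation TMc := (tangent_bundle A).
Local Notation pi_field := (TM -> 'rV[R]_n).
Implicit Types (i j k : chart_index A) (p : M).

Lemma chart_image_openW i (W : set M) : open W -> open (chart_image (A := A) i W).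
Proof.
move=> oW; rewrite openE => x /= [p [Wp ip] <-].
have im : (chart i @` chart_dom i) (chart i p) by exists p.
have := chart_inv_continuous hM im; rewrite /prop_for /continuous_at (chartK hM ip).
move=> /(_ W (open_nbhs_nbhs (conj oW Wp))) nW.
have {}nW : nbhs (chart i p) (chart_inv i @^-1` W) by [].
suff: nbhs (chart i p) (chart_image (A := A) i W) by [].
have nI := open_nbhs_nbhs (conj (@chart_image_open _ _ _ _ hM i) im).
apply: filterS (filterI nW nI) => z /= [Wz] [q iq qz]; exists q => //; split=> //.
by move: Wz; rewrite /= -qz (chartK hM iq).
Qed.

Lemma chart_imageP i (W : set M) x :
  chart_image (A := A) i W x <->
  (chart i @` chart_dom i) x /\ W (chart_inv i x).
Proof.
split=> [[p [Wp ip] <-]|[[p ip <-]]]; rewrite (chartK hM ip).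
  by split=> //; exists p.
by move=> Wp; exists p.
Qed.

Lemma chart_dom_image i j p : chart_dom i p -> chart_dom j p ->
  chart_image (A := A) i (chart_dom j) (chart i p).
Proof. by move=> ip jp; exists p. Qed.

Lemma transition_diff i j p : chart_dom i p -> chart_dom j p ->
  differentiable (transition (A := A) i j) (chart i p).
Proof.
by move=> ip jp; have [+ _] := transition_smooth hM i j 1; apply; exists p.
Qed.

Lemma transitionK i j p : chart_dom i p ->
  transition (A := A) i j (chart i p) = chart j p.
Proof. by move=> ip; rewrite /transition (chartK hM ip). Qed.

(** The chain rule for the composite of two transition maps; it makes the
    coordinates of a tangent vector independent of the intermediate chart. *)
Lemma derive_transition i j k p v :
  chart_dom i p -> chart_dom j p -> chart_dom k p ->
  'D_('D_v (transition i j) (chart i p)) (transition (A := A) j k) (chart j p) =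
  'D_v (transition i k) (chart i p).
Proof.
move=> ip jp kp; rewrite -(transitionK j ip) -derive_chain; last 2 first.
- exact: transition_diff.
- by rewrite transitionK //; exact: transition_diff.
apply: near_eq_derive.
have oj := @chart_image_openW i _ (@chart_dom_open _ _ _ _ hM j).
have := open_nbhs_nbhs (conj oj (chart_dom_image ip jp)).
apply: filterS => x /= [q [jq iq] <-].
by rewrite (transitionK j iq) /transition (chartK hM iq) (chartK hM jq).
Qed.

Lemma derive_transition_id i p v : chart_dom i p ->
  'D_v (transition (A := A) i i) (chart i p) = v.
Proof.
move=> ip; rewrite -[RHS](@derive_id _ _ (chart i p)).
apply: near_eq_derive.
have im : (chart i @` chart_dom i) (chart i p) by exists p.
have nI := open_nbhs_nbhs (conj (@chart_image_open _ _ _ _ hM i) im).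
apply: filterS nI => x [q iq <-].
by rewrite transitionK.
Qed.

Lemma tcoord_trans i j p v : chart_dom i p -> chart_dom j p ->
  'D_(tcoord i p v) (transition i j) (chart i p) = tcoord j p v.
Proof. by move=> ip jp; apply: derive_transition => //; exact: chart_at_dom. Qed.

Lemma tcoord_at p v : tcoord (chart_at A p) p v = v.
Proof. by apply: derive_transition_id; exact: chart_at_dom. Qed.

Lemma tcoord_linear i p a v w : chart_dom i p ->
  tcoord i p (a *: v + w) = a *: tcoord i p v + tcoord i p w.
Proof.
move=> ip; apply: derive_linear; apply: transition_diff => //.
exact: chart_at_dom.
Qed.

(** The preferred chart at the base point used to represent a tangent vector
    cancels by the chain rule, so the charts of the tangent bundle are bijective
    although this preferred chart does not vary continuously. *)
Lemma tchartK i (u : TM) : chart_dom i u.1 ->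
  chart_inv (c := TMc) i (chart (c := TMc) i u) = u.
Proof.
case: u => p y /= ip; rewrite row_mxKl row_mxKr (chartK hM ip).
by rewrite tcoord_trans ?tcoord_at //; exact: chart_at_dom.
Qed.

Lemma tchart_invK i z : (chart i @` chart_dom i) (lsubmx z) ->
  chart (c := TMc) i (chart_inv (c := TMc) i z) = z.
Proof.
move=> [p ip pz] /=; rewrite -pz (chartK hM ip) /tcoord.
rewrite /here derive_transition //; last exact: chart_at_dom.
by rewrite derive_transition_id // pz hsubmxK.
Qed.

Lemma tchart_imageP i (W : set TM) z :
  chart_image (A := TMc) i W z <->
  (chart i @` chart_dom i) (lsubmx z) /\ W (chart_inv (c := TMc) i z).
Proof.
split=> [[u [Wu iu] <-]|[iz Wz]].
  rewrite (tchartK iu); split=> //; exists u.1 => //=.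
  by rewrite row_mxKl.
exists (chart_inv (c := TMc) i z); last exact: tchart_invK.
split=> //=; case: iz => p ip <-; by rewrite (chartK hM ip).
Qed.

Lemma tchart_dom_inv i z : (chart i @` chart_dom i) (lsubmx z) ->
  chart_dom i (chart_inv (c := TMc) i z).1.
Proof. by move=> [p ip pz] /=; rewrite -pz (chartK hM ip). Qed.

End Manifold.

(** * Smooth sections and frames *)

Section Manifold.
Variables (R : realType) (n : nat) (M : topologicalType).
Variables (A : chartedSpace R n M) (hM : smooth_manifold A).
Local Notation TM := (M * 'rV[R]_n)%type.
Local Notation TMc := (tangent_bundle A).
Local Notation pi_field := (TM -> 'rV[R]_n).
Implicit Types (i j k : chart_index A) (p : M).

Lemma tchart_neq0 j z : (chart j @` chart_dom j) (lsubmx z) ->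
  ((chart_inv (c := TMc) j z).2 != 0) = (rsubmx z != 0).
Proof.
move=> [p jp pz] /=; rewrite -pz (chartK hM jp).
have jat := chart_at_dom hM p.
congr (~~ _); apply/eqP/eqP => [D0|->]; last by rewrite derive0.
by rewrite -(derive_transition_id hM (rsubmx z) jp)
  -(derive_transition hM (rsubmx z) jp jat jp) D0 derive0.
Qed.

Lemma slit_open_slit : slit_open A (@slit R n M).
Proof.
suff H (j : chart_index A) : open (chart_image (A := TMc) j (@slit R n M)).
  by split=> // j; exact: H.
rewrite (_ : chart_image (A := TMc) j _ =
   (lsubmx @^-1` (chart j @` chart_dom j)) `&` (rsubmx @^-1` [set y | y != 0])).
  apply: openI; apply: open_comp.
  - by move=> z _; exact: continuous_lsubmx.
  - exact: chart_image_open.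
  - by move=> z _; exact: continuous_rsubmx.
  - exact: open_neq0.
apply/seteqP; split => z.
  by move=> /(tchart_imageP hM)[jz sz]; split=> //=; rewrite -(tchart_neq0 jz).
move=> [jz sz]; apply/(tchart_imageP hM); split=> //=.
by rewrite /slit /= (tchart_neq0 jz).
Qed.

(** Sections will be expanded in a frame that exists only over one chart
    domain; its preimage is again an admissible open set. *)
Lemma slit_open_dom (O : set TM) i : slit_open A O ->
  slit_open A (O `&` [set u | chart_dom i u.1]).
Proof.
move=> [oO sO]; split; last by move=> u [/sO].
suff H (j : chart_index A) :
    open (chart_image (A := TMc) j (O `&` [set u | chart_dom i u.1])).
  by move=> j; exact: H.
rewrite (_ : chart_image (A := TMc) j _ = chart_image (A := TMc) j O `&`
    (lsubmx @^-1` (chart_image (A := A) j (chart_dom i)))).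
  apply: openI; first exact: oO.
  apply: open_comp; first by move=> z _; exact: continuous_lsubmx.
  exact/(chart_image_openW hM)/(chart_dom_open hM).
apply/seteqP; split => z.
  move=> /(tchart_imageP hM)[jz [Oz iz]]; split; first exact/(tchart_imageP hM).
  exact/(chart_imageP hM).
move=> [/(tchart_imageP hM)[jz Oz] /(chart_imageP hM)[_ iz]].
exact/(tchart_imageP hM).
Qed.

Lemma smooth_pi_field_eq O (X Y : pi_field) : slit_open A O ->
  (forall u, O u -> X u = Y u) -> smooth_pi_field A O X -> smooth_pi_field A O Y.
Proof.
move=> [oO _] XY sX i k; apply: Ck_eq (sX i k); first exact: oO.
by move=> z /(tchart_imageP hM)[_ Oz]; rewrite /= XY.
Qed.

Lemma smooth_pi_field_subset O O' (X : pi_field) : O' `<=` O ->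
  smooth_pi_field A O X -> smooth_pi_field A O' X.
Proof.
move=> sO sX i k; apply: Ck_subset (sX i k).
by move=> z [u [/sO Ou iu] uz]; exists u.
Qed.

Lemma tcoord0 i p : tcoord (A := A) i p 0 = 0.
Proof. exact: derive0. Qed.

Lemma tcoordD i p v w : chart_dom i p ->
  tcoord i p (v + w) = tcoord i p v + tcoord i p w.
Proof. by move=> ip; have := tcoord_linear hM 1 v w ip; rewrite !scale1r. Qed.

Lemma smooth_pi_field0 O : slit_open A O -> smooth_pi_field A O (fun=> 0).
Proof.
move=> [oO _] i k; apply: (@Ck_eq _ _ _ _ _ (fun=> 0)) => //.
  by move=> z _; rewrite /= tcoord0.
exact: Ck_cst.
Qed.

Lemma smooth_pi_fieldD O (X Y : pi_field) : slit_open A O ->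
  smooth_pi_field A O X -> smooth_pi_field A O Y ->
  smooth_pi_field A O (fun u => X u + Y u).
Proof.
move=> [oO _] sX sY i k; apply: (Ck_eq (oO i) _ (Ck_add (oO i) (sX i k) (sY i k))).
by move=> z /(tchart_imageP hM)[iz _]; rewrite /= tcoordD //; exact: tchart_dom_inv.
Qed.

Lemma smooth_pi_fieldZ O (f : TM -> R) (Y : pi_field) : slit_open A O ->
  smooth_function TMc O f -> smooth_pi_field A O Y ->
  smooth_pi_field A O (fun u => f u *: Y u).
Proof.
move=> [oO _] sf sY i k.
suff C : Ck k (chart_image (A := TMc) i O) (fun z =>
    f (chart_inv (c := TMc) i z) *:
    tcoord i (chart_inv (c := TMc) i z).1 (Y (chart_inv (c := TMc) i z))).
  apply: (Ck_eq (oO i) _ C) => z /(tchart_imageP hM)[iz _].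
  set u := chart_inv (c := TMc) i z.
  have := tcoord_linear hM (f u) (Y u) 0 (tchart_dom_inv hM iz).
  by rewrite !addr0 tcoord0 addr0 => E; exact: esym E.
apply: (Ck_coordP _ _ (oO i)).2 => j.
apply: (Ck_eq (oO i) _ (Ck_mul (oO i) (sf i k)
  ((Ck_coordP _ _ (oO i)).1 (sY i k) j))) => z _.
by rewrite mxE.
Qed.

Lemma smooth_pi_fieldN O (Y : pi_field) : slit_open A O ->
  smooth_pi_field A O Y -> smooth_pi_field A O (fun u => - Y u).
Proof.
move=> sO sY; have := smooth_pi_fieldZ sO _ sY (f := fun=> -1).
rewrite (_ : (fun u => -1 *: Y u) = (fun u => - Y u)); last first.
  by apply/funext => u; rewrite scaleN1r.
by apply => i k; exact: Ck_cst.
Qed.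

Lemma smooth_eta O : slit_open A O -> smooth_pi_field A O (@Defs.eta R n M).
Proof.
move=> [oO _] i k; apply: (Ck_eq (oO i) _ (@Ck_rsubmx _ k _ _ _)).
move=> z /(tchart_imageP hM)[iz _]; rewrite /Defs.eta.
have := tchart_invK hM iz; move: (tchart_dom_inv hM iz).
by case: (chart_inv (c := TMc) i z) => p y /= ip <-; rewrite row_mxKr.
Qed.

Lemma lsubmx_image j i O z : O `<=` [set u | chart_dom i u.1] ->
  chart_image (A := TMc) j O z -> chart_image (A := A) j (chart_dom i) (lsubmx z).
Proof.
move=> Oi /(tchart_imageP hM)[jz Oz]; apply/(chart_imageP hM); split=> //.
exact: Oi Oz.
Qed.

Lemma transition_image_open j i : open (chart_image (A := A) j (chart_dom i)).
Proof. exact/(chart_image_openW hM)/(chart_dom_open hM). Qed.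

(** A change of chart acts on sections by the differential of the transition
    map, which is smooth. *)
Lemma smooth_tcoord O (Y : pi_field) i l : slit_open A O ->
  O `<=` [set u | chart_dom i u.1] ->
  smooth_pi_field A O Y ->
  smooth_function TMc O (fun u => (tcoord i u.1 (Y u)) 0 l).
Proof.
move=> [oO sO] Oi sY j k.
suff C : Ck k (chart_image (A := TMc) j O)
    (fun z => tcoord i (chart_inv (c := TMc) j z).1 (Y (chart_inv (c := TMc) j z))).
  exact: (Ck_coordP _ _ (oO j)).1 C l.
apply: (Ck_eq (oO j) _ (Ck_pushforward (oO j) (@transition_image_open j i)
  (fun z => lsubmx_image Oi) (@Ck_lsubmx _ k _ _ _) (sY j k)
  (transition_smooth hM j i k.+1))).
move=> z /(tchart_imageP hM)[jz Oz].
move: (tchart_dom_inv hM jz) (tchart_invK hM jz) (Oi _ Oz).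
case: (chart_inv (c := TMc) j z) => p y /= jp <- ip; rewrite row_mxKl.
by rewrite tcoord_trans.
Qed.

(** The section over the domain of chart i with constant coordinates w in that
    chart, represented at each point in the preferred chart of this point. *)
Definition frame i (w : 'rV[R]_n) : pi_field := fun u =>
  'D_w (transition i (chart_at A u.1)) (chart i u.1).

Lemma tcoord_frame i j w u : chart_dom i u.1 -> chart_dom j u.1 ->
  tcoord j u.1 (frame i w u) = 'D_w (transition i j) (chart i u.1).
Proof.
by move=> iu ju; apply: derive_transition => //; exact: chart_at_dom.
Qed.

Lemma smooth_frame i w O : slit_open A O ->
  O `<=` [set u | chart_dom i u.1] -> smooth_pi_field A O (frame i w).
Proof.
move=> [oO sO] Oi j k.
have [_ C] := transition_smooth hM i j k.+1.
apply: (Ck_eq (oO j) _ (Ck_comp (oO j) (@transition_image_open i j)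
  _ (Ck_comp (oO j) (@transition_image_open j i) (fun z => lsubmx_image Oi)
     (@Ck_lsubmx _ k _ _ _) (transition_smooth hM j i k)) (C w))).
  move=> z /(tchart_imageP hM)[jz Oz].
  move: (tchart_dom_inv hM jz) (tchart_invK hM jz) (Oi _ Oz).
  case: (chart_inv (c := TMc) j z) => p y /= jp <- ip; rewrite row_mxKl.
  rewrite transitionK //; exact: esym (@tcoord_frame i j w (p, y) ip jp).
move=> z /(lsubmx_image Oi) [p [ip jp] <-].
by rewrite transitionK //; exact: chart_dom_image.
Qed.

Lemma frame_at w p y : frame (chart_at A p) w (p, y) = w.
Proof. by apply: (derive_transition_id hM); exact: chart_at_dom. Qed.

Lemma frame_expand i (Y : pi_field) u : chart_dom i u.1 ->
  Y u = \sum_l (tcoord i u.1 (Y u)) 0 l *: frame i (delta_mx 0 l) u.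
Proof.
move=> iu; rewrite /frame -derive_basis; last first.
  by apply: (transition_diff hM) => //; exact: chart_at_dom.
by rewrite (tcoord_trans hM) ?tcoord_at //; exact: chart_at_dom.
Qed.

End Manifold.

(** * Vertical vectors and restriction to a fibre *)

Section Manifold.
Variables (R : realType) (n : nat) (M : topologicalType).
Variables (A : chartedSpace R n M) (hM : smooth_manifold A).
Local Notation TM := (M * 'rV[R]_n)%type.
Local Notation TMc := (tangent_bundle A).
Local Notation pi_field := (TM -> 'rV[R]_n).
Implicit Types (i j k : chart_index A) (p : M).
Local Notation tm_field := (TM -> 'rV[R]_(n + n)).

Lemma gammaE (u : TM) w : gamma A u w = row_mx 0 w.
Proof.
rewrite /gamma derive1E /=.
rewrite (_ : (fun t : R => _) =
  (fun t : R => row_mx (chart (chart_at A u.1) u.1) (t *: w + u.2))); last first.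
  by apply/funext => t; rewrite (tcoord_at hM) addrC.
rewrite derive_row_mx; congr row_mx.
rewrite (_ : (fun t : R => _) = (fun t => t *: w + u.2)) //.
have df t : differentiable (fun t : R => t *: w) t by apply: differentiableZl.
rewrite [LHS]deriveD; [|exact: diff_derivable|exact: derivable_cst].
rewrite derive_cst addr0.
by rewrite -[RHS]scale1r -[X in _ = X *: _](@derive_id _ _ (0 : R))
  deriveE // (@diffZl _ _ _ id) // deriveE.
Qed.

(** The coordinates near those of u are again coordinates of tangent vectors,
    which turns the identities on chart images into identities of germs. *)
Lemma near_here (u : TM) : \forall z \near here TMc u,
  (chart (chart_at A u.1) @` chart_dom (chart_at A u.1)) (lsubmx z).
Proof.
set i := chart_at A u.1.
have o : open (lsubmx @^-1` (chart i @` chart_dom i) : set 'rV[R]_(n + n)).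
  apply: open_comp; first by move=> z _; exact: continuous_lsubmx.
  exact: (chart_image_open hM).
have h : (lsubmx @^-1` (chart i @` chart_dom i)) (here TMc u).
  exists u.1; first exact: (chart_at_dom hM).
  by rewrite /here /= row_mxKl.
exact: (open_nbhs_nbhs (conj o h)).
Qed.

Lemma tcoord_tangent_at (u : TM) v : tcoord (A := TMc) (chart_at A u.1) u v = v.
Proof.
rewrite -[RHS](@derive_id _ _ (here TMc u)); apply: near_eq_derive.
by apply: filterS (near_here u) => z /(tchart_invK hM).
Qed.

(** In the charts of the tangent bundle the projection to the base is the
    projection on the first n coordinates. *)
Lemma rhoE (u : TM) v : rho A u v = lsubmx v.
Proof.
rewrite /rho /map_deriv -[RHS](@derive_linear_map _ _ _ _ (here TMc u)); last first.
  exact: continuous_lsubmx.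
apply: near_eq_derive.
apply: filterS (near_here u) => z /= [p ip pz].
by rewrite -pz (chartK hM ip).
Qed.

Lemma here_tangent p y :
  here TMc (p, y) = row_mx (here A p) y.
Proof. by rewrite /here /= (tcoord_at hM). Qed.

Lemma chart_inv_fibre p y :
  chart_inv (c := TMc) (chart_at A p) (row_mx (here A p) y) = (p, y).
Proof.
rewrite -here_tangent /here; apply: (tchartK hM); exact: (chart_at_dom hM).
Qed.

Lemma transition_tangent (p : M) i y : chart_dom i p ->
  transition (A := TMc) (chart_at A p) i (row_mx (here A p) y) =
  row_mx (chart i p) (tcoord i p y).
Proof. by move=> ip; rewrite /transition chart_inv_fibre. Qed.

(** A transition map of the tangent bundle fixes the base point of a fibre and
    is linear on it, by the differential of the transition map of the base. *)
Lemma tcoord_vertical i (u : TM) w : chart_dom i u.1 ->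
  tcoord (A := TMc) i u (row_mx 0 w) = row_mx 0 (tcoord i u.1 w).
Proof.
case: u => p y /= ip; rewrite /tcoord here_tangent derive_row.
rewrite (_ : (fun z => _) = (fun z => row_mx (chart i p) (tcoord i p z))).
  rewrite derive_row_mx /tcoord derive_derive_dir //.
  by apply: (transition_diff hM) => //; exact: (chart_at_dom hM).
by apply/funext => z; exact: transition_tangent.
Qed.

Lemma vf_coord_vertical i (X : pi_field) z : (chart i @` chart_dom i) (lsubmx z) ->
  vf_coord (A := TMc) i (gammaf A X) z =
  row_mx 0 (tcoord i (chart_inv (c := TMc) i z).1 (X (chart_inv (c := TMc) i z))).
Proof.
move=> iz; rewrite /vf_coord /gammaf gammaE tcoord_vertical //.
exact: tchart_dom_inv.
Qed.

Lemma smooth_gammaf O (X : pi_field) : slit_open A O -> smooth_pi_field A O X ->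
  smooth_vector_field TMc O (gammaf A X).
Proof.
move=> [oO _] sX i k.
apply: (Ck_eq (oO i) _ (Ck_row_mx (oO i) (Ck_cst _ _ 0) (sX i k))).
by move=> z /(tchart_imageP hM)[iz _]; rewrite vf_coord_vertical.
Qed.

Lemma vf_coord_fibre (X : pi_field) p y :
  vf_coord (A := TMc) (chart_at A p) (gammaf A X) (row_mx (here A p) y) =
  row_mx 0 (X (p, y)).
Proof.
rewrite vf_coord_vertical; last first.
  by rewrite row_mxKl; exists p => //; exact: (chart_at_dom hM).
by rewrite chart_inv_fibre /= (tcoord_at hM).
Qed.

Lemma function_deriv_fibre (f : TM -> R) p y v :
  function_deriv TMc f (p, y) (row_mx 0 v) = 'D_v (fun y => f (p, y)) y.
Proof.
rewrite /function_deriv here_tangent derive_row; congr ('D_v _ y).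
by apply/funext => z /=; rewrite -[in RHS]chart_inv_fibre.
Qed.

(** Vertical fields are tangent to the fibre, where they bracket as vector
    fields on an open subset of the model space. *)
Lemma lie_bracket_vertical (X Y : pi_field) p y :
  lie_bracket TMc (gammaf A X) (gammaf A Y) (p, y) =
  row_mx 0 ('D_(X (p, y)) (fun y => Y (p, y)) y -
            'D_(Y (p, y)) (fun y => X (p, y)) y).
Proof.
have gE Z : gammaf A Z (p, y) = row_mx 0 (Z (p, y)) by exact: gammaE.
have fE Z : (fun y => vf_coord (A := TMc) (chart_at A p) (gammaf A Z)
    (row_mx (here A p) y)) = (fun y => row_mx 0 (Z (p, y))).
  by apply/funext => z; exact: vf_coord_fibre.
have dE Z Z' : 'D_(gammaf A Z (p, y))
      (vf_coord (A := TMc) (chart_at A p) (gammaf A Z')) (here TMc (p, y)) =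
    row_mx 0 ('D_(Z (p, y)) (fun y => Z' (p, y)) y).
  by rewrite gE here_tangent derive_row fE derive_row_mx.
apply: etrans (congr2 (fun a b => a - b) (dE X Y) (dE Y X)) _.
by rewrite opp_row_mx add_row_mx oppr0 addr0.
Qed.

Definition fibre (O : set TM) (p : M) : set 'rV[R]_n := [set y | O (p, y)].

Lemma fibre_image (O : set TM) p y : fibre O p y ->
  chart_image (A := TMc) (chart_at A p) O (row_mx (here A p) y).
Proof.
move=> Oy; rewrite -here_tangent; exists (p, y) => //; split => //.
exact: (chart_at_dom hM).
Qed.

Lemma fibre_imageE (O : set TM) p :
  fibre O p = row_mx (here A p) @^-1` chart_image (A := TMc) (chart_at A p) O.
Proof.
apply/seteqP; split => y; first exact: fibre_image.
by move=> /(tchart_imageP hM)[_]; rewrite chart_inv_fibre.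
Qed.

Lemma fibre_open (O : set TM) p : slit_open A O -> open (fibre O p).
Proof.
move=> [oO _]; rewrite fibre_imageE; apply: open_comp; last exact: oO.
by move=> y _; exact: continuous_row_cst.
Qed.

Lemma fibre_smooth O (X : pi_field) p (k : nat) :
  slit_open A O -> smooth_pi_field A O X ->
  Ck k (fibre O p) (fun y => X (p, y)).
Proof.
move=> sO sX; have oF := @fibre_open O p sO.
apply: (Ck_eq oF _ (Ck_comp oF (sO.1 _) (fun y => @fibre_image O p y)
  (Ck_row_cst _ _ oF) (sX (chart_at A p) k))) => y Oy.
by rewrite (chart_inv_fibre p y) /= (tcoord_at hM).
Qed.

Lemma fibre_smooth_function O (f : TM -> R) p (k : nat) : slit_open A O ->
  smooth_function TMc O f -> Ck k (fibre O p) (fun y => f (p, y)).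
Proof.
move=> sO sf; have oF := @fibre_open O p sO.
apply: (Ck_eq oF _ (Ck_comp_scalar oF (sO.1 _) (fun y => @fibre_image O p y)
  (Ck_row_cst _ _ oF) (sf (chart_at A p) k))) => y Oy.
by rewrite (chart_inv_fibre p y).
Qed.

End Manifold.

(** * The vertical part of a linear connection *)

Section Manifold.
Variables (R : realType) (n : nat) (M : topologicalType).
Variables (A : chartedSpace R n M) (hM : smooth_manifold A).
Local Notation TM := (M * 'rV[R]_n)%type.
Local Notation TMc := (tangent_bundle A).
Local Notation pi_field := (TM -> 'rV[R]_n).
Implicit Types (i j k : chart_index A) (p : M).
Variable nabla : connection R n M.

Section Linear.
Hypothesis hN : linear_connection A nabla.

Lemma nabla0 O u v : slit_open A O -> O u -> nabla (fun=> 0) u v = 0.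
Proof.
move=> sO Ou; have s0 := smooth_pi_field0 sO.
have := nabla_add hN sO s0 s0 Ou v.
rewrite (_ : (fun w : TM => 0 + 0) = (fun=> 0)); last first.
  by apply/funext => w; rewrite addr0.
by move/eqP; rewrite -subr_eq0 opprD addrA subrr add0r oppr_eq0 => /eqP.
Qed.

Lemma nabla_sum O m (F : 'I_m -> pi_field) u v : slit_open A O -> O u ->
  (forall l, smooth_pi_field A O (F l)) ->
  smooth_pi_field A O (fun w => \sum_l F l w) /\
  nabla (fun w => \sum_l F l w) u v = \sum_l nabla (F l) u v.
Proof.
move=> sO Ou sF; rewrite -fct_sumE.
elim/big_rec2: _ => [|l a G _ [sG <-]].
  split; first exact: smooth_pi_field0.
  exact: (@nabla0 O).
split; first exact: (smooth_pi_fieldD hM sO (sF l) sG).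
exact: (nabla_add hN sO (sF l) sG Ou v).
Qed.

(** The term of order zero of the vertical part of the connection: its
    Christoffel symbols in the frame of the preferred chart at p, contracted
    with w. *)
Definition vchris (p : M) (y v w : 'rV[R]_n) : 'rV[R]_n :=
  \sum_l w 0 l *: nabla (frame (chart_at A p) (delta_mx 0 l)) (p, y) (row_mx 0 v).

(** The frame of chart i is defined on this open set, which contains the
    whole slit fibre over each point of the chart domain. *)
Definition slit_over i : set TM := @slit R n M `&` [set u | chart_dom i u.1].

Lemma slit_open_over i : slit_open A (slit_over i).
Proof. exact/(slit_open_dom hM)/(slit_open_slit hM). Qed.

Lemma smooth_frame_over i w : smooth_pi_field A (slit_over i) (frame i w).
Proof. by apply: (smooth_frame hM); [exact: slit_open_over|move=> u []]. Qed.

Lemma slit_over_at p y : y != 0 -> slit_over (chart_at A p) (p, y).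
Proof. by move=> y0; split => //=; exact: (chart_at_dom hM). Qed.

(** Expand Y in the frame of the preferred chart at p and apply the Leibniz
    rule. *)
Lemma nabla_vertical O (Y : pi_field) p y v : slit_open A O ->
  smooth_pi_field A O Y -> O (p, y) ->
  nabla Y (p, y) (row_mx 0 v) =
  'D_v (fun y => Y (p, y)) y + vchris p y v (Y (p, y)).
Proof.
move=> sO sY Oy; set i := chart_at A p.
pose W := O `&` [set u | chart_dom i u.1].
have sW : slit_open A W by exact: slit_open_dom.
have Wy : W (p, y) by split => //=; exact: (chart_at_dom hM).
have Wi : W `<=` [set u | chart_dom i u.1] by move=> u [].
have sYW : smooth_pi_field A W Y by apply: smooth_pi_field_subset sY => u [].
pose c l u := (tcoord i u.1 (Y u)) 0 l.
pose E l := frame i (delta_mx 0 l).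
have sc l : smooth_function TMc W (c l) by exact: smooth_tcoord.
have sE l : smooth_pi_field A W (E l) by exact: smooth_frame.
have scE l := smooth_pi_fieldZ hM sW (sc l) (sE l).
have [sS nS] := nabla_sum (row_mx 0 v) sW Wy scE.
have -> : nabla Y (p, y) (row_mx 0 v) =
    nabla (fun u => \sum_l c l u *: E l u) (p, y) (row_mx 0 v).
  apply: (nabla_local hN sW sYW sS Wy) => u [_ iu].
  exact: (frame_expand hM _ iu).
apply: etrans nS _.
have dY : differentiable (fun y => Y (p, y)) y.
  exact: (fibre_smooth hM p 1 sO sY).1 y Oy.
rewrite (row_sum_delta ('D_v (fun y => Y (p, y)) y)) -big_split.
apply: eq_bigr => l _ /=.
apply: etrans (nabla_leibniz hN sW (sc l) (sE l) Wy (row_mx 0 v)) _.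
have cE z : c l (p, z) = Y (p, z) 0 l by rewrite /c /= (tcoord_at hM).
have dcE : function_deriv TMc (c l) (p, y) (row_mx 0 v) =
    ('D_v (fun y => Y (p, y)) y) 0 l.
  apply: etrans (function_deriv_fibre hM (c l) p y v) _.
  apply: etrans (congr1 (fun F => 'D_v F y) (funext cE)) _.
  exact: esym (derive_coord l (diff_derivable dY)).
by rewrite dcE cE /E (frame_at hM).
Qed.

Lemma vchris_linear_r p y v a w w' :
  vchris p y v (a *: w + w') = a *: vchris p y v w + vchris p y v w'.
Proof.
rewrite /vchris scaler_sumr -big_split; apply: eq_bigr => l _ /=.
by rewrite !mxE scalerDl scalerA.
Qed.

Lemma vchris_linear_l p y a v v' w : y != 0 ->
  vchris p y (a *: v + v') w = a *: vchris p y v w + vchris p y v' w.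
Proof.
move=> y0; rewrite /vchris scaler_sumr -big_split; apply: eq_bigr => l _ /=.
rewrite (_ : row_mx 0 (a *: v + v') = a *: row_mx 0 v + row_mx 0 v'); last first.
  by rewrite scale_row_mx add_row_mx scaler0 addr0.
rewrite (nabla_linear hN (slit_open_over (chart_at A p)) (smooth_frame_over _ _)
  (slit_over_at p y0)).
by rewrite scalerDr !scalerA [_ * a]mulrC.
Qed.

Lemma vchris_differentiable p y v w : y != 0 ->
  differentiable (fun y => vchris p y v w) y.
Proof.
move=> y0; set i := chart_at A p.
have sO := slit_open_over i.
have d l : differentiable
    (fun y => nabla (frame i (delta_mx 0 l)) (p, y) (row_mx 0 v)) y.
  have sg := smooth_gammaf hM sO (smooth_frame_over i v).
  have sn := nabla_smooth hN sO sg (smooth_frame_over i (delta_mx 0 l)).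
  have [+ _] := fibre_smooth hM p 1 sO sn.
  move=> /(_ y (slit_over_at p y0)); congr (differentiable _ _).
  apply/funext => z; rewrite /gammaf (gammaE hM).
  by rewrite (frame_at hM).
rewrite (_ : (fun y => _) = \sum_l (fun y => w 0 l *:
    nabla (frame i (delta_mx 0 l)) (p, y) (row_mx 0 v))); last first.
  by apply/funext => z; rewrite fct_sumE.
by apply: differentiable_sum => l; apply: differentiableZ.
Qed.

End Linear.
End Manifold.

(** * The vertical part of the Cartan connection *)

Section Manifold.
Variables (R : realType) (n : nat) (M : topologicalType).
Variables (A : chartedSpace R n M) (hM : smooth_manifold A).
Local Notation TM := (M * 'rV[R]_n)%type.
Local Notation TMc := (tangent_bundle A).
Local Notation pi_field := (TM -> 'rV[R]_n).
Implicit Types (i j k : chart_index A) (p : M).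
Local Notation tm_field := (TM -> 'rV[R]_(n + n)).

Lemma rho_gamma X u : rhof A (gammaf A X) u = 0.
Proof. by rewrite /rhof /gammaf (gammaE hM) (rhoE hM) row_mxKl. Qed.

(** Its Hessian is twice the metric of the fibre over p. *)
Definition energy (L : TM -> R) p (y : 'rV[R]_n) : R := L (p, y) ^+ 2.

Section Cartan.
Variables (nabla : connection R n M) (L : TM -> R).
Hypothesis hL : finsler_manifold A L.
Hypothesis hC : cartan_connection A nabla L.
Let hN := cartan_linear hC.

(** The horizontal part of any vector that projects to w still projects to w,
    so the horizontal lift exists. *)
Lemma rho_beta u w : u.2 != 0 -> rho A u (Defs.beta A nabla u w) = w.
Proof.
move=> u0; suff [] : [set v | horizontal nabla u v /\ rho A u v = w]
  (Defs.beta A nabla u w) by [].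
apply: xgetPex.
have [ex _] := cartan_regular hC u0.
have [a [b [va hb ab]]] := ex (row_mx w 0).
exists b; split=> //.
have : rho A u (row_mx w 0) = rho A u a + rho A u b.
  by rewrite ab !(rhoE hM) linearD.
by rewrite va add0r (rhoE hM) row_mxKl => <-.
Qed.

Lemma rho_betaf_frame i w u : u.2 != 0 ->
  rhof A (betaf A nabla (frame i w)) u = frame i w u.
Proof. exact: rho_beta. Qed.

(** Along the fibre both fields project to sections with constant coordinates:
    w for the horizontal lift, 0 for the vertical field. *)
Lemma rho_bracket_frames p y v w : y != 0 ->
  rho A (p, y) (lie_bracket TMc (gammaf A (frame (chart_at A p) v))
    (betaf A nabla (frame (chart_at A p) w)) (p, y)) = 0.
Proof.
move=> y0; rewrite (rhoE hM); set i := chart_at A p.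
set b := betaf A nabla (frame i w).
have l1 : lsubmx ('D_(gammaf A (frame i v) (p, y))
    (vf_coord (A := TMc) i b) (here TMc (p, y))) = 0.
  apply: lsubmx_derive => j.
  rewrite /gammaf (gammaE hM) (here_tangent hM) derive_row.
  rewrite -[RHS](@derive_cst _ _ _ (w 0 j) y (frame i v (p, y))).
  apply: near_eq_derive.
  apply: filterS (open_nbhs_nbhs (conj (@open_neq0 R 'rV[R]_n) y0)) => z /= z0.
  have -> : vf_coord (A := TMc) i b (row_mx (here A p) z) = b (p, z).
    rewrite /vf_coord (chart_inv_fibre hM).
    exact: (tcoord_tangent_at hM (p, z)).
  rewrite -(rhoE hM (p, z)).
  have -> : rho A (p, z) (b (p, z)) = frame i w (p, z) by exact: rho_betaf_frame.
  by rewrite (frame_at hM).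
have l2 : lsubmx ('D_(b (p, y))
    (vf_coord (A := TMc) i (gammaf A (frame i v))) (here TMc (p, y))) = 0.
  apply: lsubmx_derive => j.
  rewrite -[RHS](@derive_cst _ _ _ (0 : R) (here TMc (p, y)) (b (p, y))).
  apply: near_eq_derive.
  apply: filterS (near_here hM (p, y)) => z iz.
  by rewrite (vf_coord_vertical hM) // row_mxKl mxE.
apply: etrans (linearB _ _ _) _.
by apply: etrans (congr2 (fun a b => a - b) l1 l2) _; rewrite subr0.
Qed.

(** Fields that are constant along the fibre isolate the term of order zero. *)
Lemma torsionT_frames p y v w : y != 0 ->
  torsionT A nabla (frame (chart_at A p) v) (frame (chart_at A p) w) (p, y) =
  vchris A nabla p y v w.
Proof.
move=> y0; set i := chart_at A p.
have sO := slit_open_over hM i; have Oy := slit_over_at hM p y0.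
have sw := smooth_frame_over hM i w.
rewrite /torsionT /torsion rho_bracket_frames // subr0.
have -> : cov nabla (betaf A nabla (frame i w)) (rhof A (gammaf A (frame i v)))
    (p, y) = 0.
  rewrite /cov (_ : rhof A (gammaf A (frame i v)) = (fun=> 0)); last first.
    by apply/funext => u; exact: rho_gamma.
  exact: (nabla0 hN _ sO Oy).
rewrite subr0 /cov.
have eqb u : slit_over i u -> rhof A (betaf A nabla (frame i w)) u = frame i w u.
  by move=> [u0 _]; exact: rho_betaf_frame.
have sb : smooth_pi_field A (slit_over i) (rhof A (betaf A nabla (frame i w))).
  exact: (smooth_pi_field_eq hM sO (fun u Ou => esym (eqb u Ou)) sw).
rewrite (nabla_local hN sO sb sw Oy eqb) /gammaf (gammaE hM) (frame_at hM).
rewrite (nabla_vertical hM hN v sO sw Oy) (frame_at hM).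
rewrite (_ : (fun y => frame i w (p, y)) = (fun=> w)); last first.
  by apply/funext => z; rewrite (frame_at hM).
by rewrite derive_cst add0r.
Qed.

Lemma finsler_metricE p y v w :
  finsler_metric L (p, y) v w = 2^-1 * hessian (energy L p) y v w.
Proof. by []. Qed.

Let o0 := @open_neq0 R 'rV[R]_n.

Lemma energy_smooth p (k : nat) : Ck k [set y : 'rV[R]_n | y != 0] (energy L p).
Proof.
have CL := fibre_smooth_function hM p k (slit_open_slit hM) (finsler_smooth hL).
rewrite (_ : energy L p = (fun y => L (p, y) * L (p, y))); last first.
  by apply/funext => y; rewrite /energy expr2.
exact: Ck_mul.
Qed.

Lemma energy_homogeneous p (t : R) y : 0 < t -> y != 0 ->
  energy L p (t *: y) = t ^+ 2 * energy L p y.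
Proof. by move=> t0 y0; rewrite /energy (finsler_homogeneous hL) // exprMn. Qed.

Lemma energy_posdef p y v : y != 0 -> v != 0 -> 0 < hessian (energy L p) y v v.
Proof.
move=> y0 v0; have := finsler_posdef hL (u := (p, y)) y0 v0.
by rewrite finsler_metricE pmulr_rgt0 // invr_gt0 ltr0n.
Qed.

Local Notation C p := (vchris A nabla p).

Lemma vchris_sym p y v w z : y != 0 ->
  hessian (energy L p) y (C p y v w) z = hessian (energy L p) y (C p y v z) w.
Proof.
move=> y0; pose f := frame (chart_at A p).
have sO := slit_open_over hM (chart_at A p); have Oy := slit_over_at hM p y0.
have sf x := smooth_frame_over hM (chart_at A p) x.
have fE x : f x (p, y) = x by exact: frame_at.
have E x x' x'' : finsler_metric L (p, y) (torsionT A nabla (f x) (f x') (p, y))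
    (f x'' (p, y)) = 2^-1 * hessian (energy L p) y (C p y x x') x''.
  by rewrite (torsionT_frames p x x' y0) fE.
have := etrans (esym (E v w z))
  (etrans (cartan_T hC sO (sf v) (sf w) (sf z) Oy) (E v z w)).
by apply: mulfI; rewrite invr_eq0 pnatr_eq0.
Qed.

Lemma vchris_metric p y v w z : y != 0 ->
  'D_v (fun y => hessian (energy L p) y w z) y =
  hessian (energy L p) y (C p y v w) z + hessian (energy L p) y w (C p y v z).
Proof.
move=> y0; set i := chart_at A p.
have sO := slit_open_over hM i; have Oy := slit_over_at hM p y0.
have sf := smooth_frame_over hM i.
have nE x : nabla (frame i x) (p, y) (row_mx 0 v) = C p y v x.
  rewrite (nabla_vertical hM hN v sO (sf x) Oy) (frame_at hM).
  rewrite (_ : (fun y => frame i x (p, y)) = (fun=> x)); last first.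
    by apply/funext => u; rewrite (frame_at hM).
  by rewrite derive_cst add0r.
have := cartan_metric hC sO (sf w) (sf z) Oy (row_mx 0 v).
rewrite (nE w) (nE z) (frame_at hM w p y) (frame_at hM z p y).
rewrite (finsler_metricE p y (C p y v w) z) (finsler_metricE p y w (C p y v z)).
have E : function_deriv TMc (fun u => finsler_metric L u (frame i w u) (frame i z u))
    (p, y) (row_mx 0 v) = 2^-1 * 'D_v (fun y => hessian (energy L p) y w z) y.
  apply: etrans (function_deriv_fibre hM _ p y v) _.
  have fE : (fun y => finsler_metric L (p, y) (frame i w (p, y)) (frame i z (p, y)))
      = (fun y => 2^-1 *: hessian (energy L p) y w z).
    by apply/funext => u; rewrite !(frame_at hM).
  apply: etrans (congr1 (fun G => 'D_v G y) fE) _.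
  apply: deriveZ; apply: diff_derivable.
  have [_ dF] := energy_smooth p 3; have [_ dd] := dF z.
  exact: (dd w).1 y y0.
move=> H; apply: (mulfI (_ : (2^-1 : R) != 0)); first by rewrite invr_eq0 pnatr_eq0.
by rewrite mulrDr -H E.
Qed.

End Cartan.
End Manifold.

(** * The v-curvature and its recurrence *)

Section Manifold.
Variables (R : realType) (n : nat) (M : topologicalType).
Variables (A : chartedSpace R n M) (hM : smooth_manifold A).
Local Notation TM := (M * 'rV[R]_n)%type.
Local Notation TMc := (tangent_bundle A).
Local Notation pi_field := (TM -> 'rV[R]_n).
Implicit Types (i j k : chart_index A) (p : M).
Variables (nabla : connection R n M) (L : TM -> R).
Hypothesis hL : finsler_manifold A L.
Hypothesis hC : cartan_connection A nabla L.
Let hN := cartan_linear hC.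
Local Notation C p := (vchris A nabla p).
Let o0 := @open_neq0 R 'rV[R]_n.

Lemma vchris_comm p y v w : y != 0 -> C p y v w = C p y w v.
Proof.
move=> y0; exact: (C_comm o0 (energy_smooth hM hL p)
  (energy_posdef hL p) (vchris_sym hM hC p) (vchris_metric hM hL hC p)).
Qed.

Lemma vchris_radial_r p y v : y != 0 -> C p y v y = 0.
Proof.
move=> y0; exact: (C_radial o0 (energy_smooth hM hL p)
  (energy_homogeneous hL p) (energy_posdef hL p) (vchris_sym hM hC p)
  (vchris_metric hM hL hC p)).
Qed.

Lemma vchris_radial_l p y v : y != 0 -> C p y y v = 0.
Proof. by move=> y0; rewrite vchris_comm // vchris_radial_r. Qed.

Lemma derive_vchris_radial p y v w : y != 0 ->
  'D_y (fun y => C p y v w) y = - C p y v w.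
Proof.
move=> y0; exact: (derive_C_radial o0 (energy_smooth hM hL p)
  (energy_homogeneous hL p) (energy_posdef hL p) (vchris_sym hM hC p)
  (vchris_metric hM hL hC p) (fun y v w => vchris_differentiable hM hN p v w)).
Qed.

Section Sections.
Variables (O : set TM) (sO : slit_open A O).
Local Notation eta := (@Defs.eta R n M).
Local Notation smooth := (smooth_pi_field A O).
Local Notation c X := (cov nabla (gammaf A X)).
Local Notation S := (v_curvature A nabla).
Implicit Types (X Y Z W U : pi_field) (u : TM).

Let O_neq0 u : O u -> u.2 != 0. Proof. exact: sO.2. Qed.

Lemma smooth_cov X Y : smooth X -> smooth Y -> smooth (c X Y).
Proof. by move=> sX sY; apply: (nabla_smooth hN sO _ sY); exact: smooth_gammaf. Qed.

(** Inside the fibre over p the vertical covariant derivative is a linear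
    connection with symbols [vchris]. *)
Lemma cov_fibre X Y p y : smooth Y -> O (p, y) ->
  c X Y (p, y) = 'D_(X (p, y)) (fun y => Y (p, y)) y + C p y (X (p, y)) (Y (p, y)).
Proof.
move=> sY Oy; rewrite /cov /gammaf (gammaE hM).
exact: (nabla_vertical hM hN _ sO sY Oy).
Qed.

(** The field eta restricts to the identity of the fibre, and C (v, y) = 0. *)
Lemma cov_eta X u : O u -> c X eta u = X u.
Proof.
case: u => p y Oy; have y0 := O_neq0 Oy.
rewrite (cov_fibre X (smooth_eta hM sO) Oy) [eta (p, y)]/= vchris_radial_r // addr0.
by rewrite (_ : (fun y => eta (p, y)) = id) ?derive_id //; exact/funext.
Qed.

Lemma eq_cov X X' Y Y' u : O u -> smooth Y ->
  X u = X' u -> (forall w, O w -> Y w = Y' w) -> c X Y u = c X' Y' u.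
Proof.
move=> Ou sY XX' YY'; rewrite /cov /gammaf XX'.
exact: (nabla_local hN sO sY (smooth_pi_field_eq hM sO YY' sY) Ou YY').
Qed.

Lemma cov0 X u : O u -> c X (fun=> 0) u = 0.
Proof. by move=> Ou; exact: (nabla0 hN (gammaf A X u) sO Ou). Qed.

Lemma covD X Y Z u : O u -> smooth Y -> smooth Z ->
  c X (fun w => Y w + Z w) u = c X Y u + c X Z u.
Proof. by move=> Ou sY sZ; exact: (nabla_add hN sO sY sZ Ou). Qed.

Lemma covN X Y u : O u -> smooth Y -> c X (fun w => - Y w) u = - c X Y u.
Proof.
move=> Ou sY; apply: (addrI (c X Y u)); rewrite subrr.
apply: etrans (esym (covD X Ou sY (smooth_pi_fieldN hM sO sY))) _.
rewrite (_ : (fun w => _) = (fun=> 0)); first exact: cov0.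
by apply/funext => w; rewrite subrr.
Qed.

Lemma covBl X X' Y u : O u -> smooth Y ->
  c (fun w => X w - X' w) Y u = c X Y u - c X' Y u.
Proof.
move=> Ou sY; rewrite /cov /gammaf !(gammaE hM).
have -> : row_mx 0 (X u - X' u) =
    (- 1) *: row_mx 0 (X' u) + row_mx 0 (X u) :> 'rV[R]_(n + n).
  by rewrite scaleN1r opp_row_mx add_row_mx oppr0 addr0 addrC.
by rewrite (nabla_linear hN sO sY Ou) scaleN1r addrC.
Qed.

Lemma covDl X X' Y u : O u -> smooth Y ->
  c (fun w => X w + X' w) Y u = c X Y u + c X' Y u.
Proof.
move=> Ou sY; rewrite /cov /gammaf !(gammaE hM).
have -> : row_mx 0 (X u + X' u) =
    1 *: row_mx 0 (X u) + row_mx 0 (X' u) :> 'rV[R]_(n + n).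
  by rewrite scale1r add_row_mx addr0.
by rewrite (nabla_linear hN sO sY Ou) scale1r.
Qed.

(** The vertical torsion is the antisymmetric part of C, hence zero. *)
Lemma lie_bracket_gamma X Y u : O u -> smooth X -> smooth Y ->
  lie_bracket TMc (gammaf A X) (gammaf A Y) u = gamma A u (c X Y u - c Y X u).
Proof.
case: u => p y Oy sX sY; have y0 := O_neq0 Oy.
rewrite (lie_bracket_vertical hM) (gammaE hM); apply: (congr1 (row_mx 0)).
apply/esym; apply: etrans
  (congr2 (fun a b => a - b) (cov_fibre X sY Oy) (cov_fibre Y sX Oy)) _.
rewrite (vchris_comm p (Y (p, y)) (X (p, y)) y0).
by move: ('D__ _ y) ('D__ _ y) (C p y _ _) => a b d; rewrite opprD addrACA subrr addr0.
Qed.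

Lemma curvatureE X Y Z u : O u -> smooth X -> smooth Y -> smooth Z ->
  S X Y Z u = - c X (c Y Z) u + c Y (c X Z) u + (c (c X Y) Z u - c (c Y X) Z u).
Proof.
move=> Ou sX sY sZ.
apply: (congr1 (fun t => - c X (c Y Z) u + c Y (c X Z) u + t)).
apply: etrans (congr1 (nabla Z u) (lie_bracket_gamma Ou sX sY)) _.
exact: (covBl (c X Y) (c Y X) Ou sZ).
Qed.

Lemma smooth_curvature X Y Z : smooth X -> smooth Y -> smooth Z ->
  smooth (S X Y Z).
Proof.
move=> sX sY sZ.
apply: (smooth_pi_field_eq hM sO (fun u Ou => esym (curvatureE Ou sX sY sZ))).
exact: (smooth_pi_fieldD hM sO
  (smooth_pi_fieldD hM sO (smooth_pi_fieldN hM sO (smooth_cov sX (smooth_cov sY sZ)))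
    (smooth_cov sY (smooth_cov sX sZ)))
  (smooth_pi_fieldD hM sO (smooth_cov (smooth_cov sX sY) sZ)
    (smooth_pi_fieldN hM sO (smooth_cov (smooth_cov sY sX) sZ)))).
Qed.

(** In the fibre nabla_eta is the plain derivative along y, as C (y, .) = 0.
    The second derivatives cancel by symmetry, and of the terms in C there
    remains - (D_y C) (Y, Z) - C (Y, Z), which vanishes because C has degree -1. *)
Lemma curvature_eta Y Z u : O u -> smooth Y -> smooth Z -> S eta Y Z u = 0.
Proof.
case: u => p y Oy sY sZ; have y0 := O_neq0 Oy.
have sE := smooth_eta hM sO.
set Yp := fun y => Y (p, y); set Zp := fun y => Z (p, y).
have oF := fibre_open hM (p := p) sO.
have Fy : fibre O p y by [].
have CZ (k : nat) : Ck k (fibre O p) Zp by exact: (fibre_smooth hM p k sO sZ).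
have dY : differentiable Yp y by exact: (fibre_smooth hM p 1 sO sY).1.
have dZ : differentiable Zp y by exact: (CZ 1).1.
pose Y0 := Yp y; pose Z0 := Zp y; pose Y' := 'D_y Yp y.
pose Z' := 'D_y Zp y.
have F0 z : fibre O p z -> z != 0 by move=> /O_neq0.
have cE W (sW : smooth W) z (Oz : O (p, z)) :
    c eta W (p, z) = 'D_z (fun y => W (p, y)) z.
  apply: etrans (cov_fibre eta sW Oz) _.
  exact: etrans (congr1 (fun t => 'D_z _ z + t)
    (vchris_radial_l p (W (p, z)) (F0 _ Oz))) (addr0 _).
have e1 : c eta (c Y Z) (p, y) =
    ('D_y ('D_Y0 Zp) y + 'D_Y' Zp y) + (- C p y Y0 Z0 + C p y Y' Z0 + C p y Y0 Z').
  apply: etrans (cE _ (smooth_cov sY sZ) y Oy) _.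
  have nE : \forall z \near y, c Y Z (p, z) = 'D_(Yp z) Zp z + C p z (Yp z) (Zp z).
    by apply: filterS (open_nbhs_nbhs (conj oF Fy)) => z Oz; exact: (cov_fibre Y sZ Oz).
  apply: etrans (near_eq_derive y nE) _.
  have dC v w : differentiable (fun z => C p z v w) y.
    exact: (vchris_differentiable hM hN p v w y0).
  have linl z w : fibre O p z -> forall a v v',
      C p z (a *: v + v') w = a *: C p z v w + C p z v' w.
    by move=> /F0 z0 a v v'; exact: (vchris_linear_l hM hN p a v v' w z0).
  have linr z v : fibre O p z -> forall a w w',
      C p z v (a *: w + w') = a *: C p z v w + C p z v w'.
    by move=> _ a w w'; exact: vchris_linear_r.
  have d1 : differentiable (fun z => 'D_(Yp z) Zp z) y.
    apply: (@differentiable_linear_field _ _ _ _ (fibre O p) (fun z v => 'D_v Zp z)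
      Yp y oF Fy _ _ dY).
      by move=> z Fz a v w; apply: derive_linear; exact: (CZ 1).1.
    by move=> v; exact: ((CZ 2).2 v).1.
  have d2 : differentiable (fun z => C p z (Yp z) (Zp z)) y.
    apply: (@differentiable_linear_field _ _ _ _ (fibre O p)
      (fun z w => C p z (Yp z) w) Zp y oF Fy _ _ dZ).
      by move=> z Fz; exact: linr.
    move=> w; apply: (@differentiable_linear_field _ _ _ _ (fibre O p)
      (fun z v => C p z v w) Yp y oF Fy _ _ dY).
      by move=> z Fz; exact: linl.
    by move=> v; exact: dC.
  apply: etrans (deriveD (diff_derivable d1) (diff_derivable d2)) _.
  apply: congr2; first exact: (derive_derive_field y oF Fy (CZ 2) dY).
  apply: etrans (derive_bilinear_field y oF Fy linl linr dC dY dZ) _.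
  by rewrite (derive_vchris_radial p Y0 Z0 y0).
have e2 : c Y (c eta Z) (p, y) =
    'D_Y0 ('D_y Zp) y + 'D_Y0 Zp y + C p y Y0 Z'.
  apply: etrans (cov_fibre Y (smooth_cov sE sZ) Oy) _.
  apply: congr2; last exact: (congr1 (C p y Y0) (cE Z sZ y Oy)).
  have nE : \forall z \near y, c eta Z (p, z) = 'D_z Zp z.
    by apply: filterS (open_nbhs_nbhs (conj oF Fy)) => z Oz; exact: (cE Z sZ).
  apply: etrans (near_eq_derive _ nE) _.
  have did : differentiable (id : 'rV[R]_n -> _) y by exact: ex_diff.
  apply: etrans (derive_derive_field Y0 oF Fy (CZ 2) did) _.
  by rewrite derive_id.
have sw : 'D_y ('D_Y0 Zp) y = 'D_Y0 ('D_y Zp) y.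
  exact: (schwarz Y0 y oF (CZ 2) Fy).
have e3 : c (c eta Y) Z (p, y) = 'D_Y' Zp y + C p y Y' Z0.
  by apply: etrans (cov_fibre (c eta Y) sZ Oy) _; rewrite (cE Y sY y Oy).
have e4 : c (c Y eta) Z (p, y) = 'D_Y0 Zp y + C p y Y0 Z0.
  by apply: etrans (cov_fibre (c Y eta) sZ Oy) _; rewrite (cov_eta Y Oy).
have alg (t1 t2 t3 t4 a b d e f g s : 'rV[R]_n) :
    t1 = (s + b) + (- d + e + f) -> t2 = a + g + f -> s = a ->
    t3 = b + e -> t4 = g + d -> - t1 + t2 + (t3 - t4) = 0.
  by move=> -> -> -> -> ->; apply/rowP => j; rewrite !mxE; ring.
exact: etrans (curvatureE Oy sE sY sZ) (alg _ _ _ _ _ _ _ _ _ _ _ e1 e2 sw e3 e4).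
Qed.

Lemma eq_curvature_l X X' Y Z u : O u -> smooth X -> smooth Y -> smooth Z ->
  (forall w, O w -> X w = X' w) -> S X Y Z u = S X' Y Z u.
Proof.
move=> Ou sX sY sZ XX'.
have sX' := smooth_pi_field_eq hM sO XX' sX.
have sXZ := smooth_cov sX sZ; have sYX := smooth_cov sY sX.
have eXZ w : O w -> c X Z w = c X' Z w.
  by move=> Ow; exact: (eq_cov Ow sZ (XX' w Ow) (fun _ _ => erefl)).
have e1 := eq_cov Ou (smooth_cov sY sZ) (XX' u Ou) (fun _ _ => erefl).
have e2 := eq_cov Ou sXZ (erefl (Y u)) eXZ.
have e3 : c (c X Y) Z u = c (c X' Y) Z u.
  apply: (eq_cov Ou sZ _ (fun _ _ => erefl)).
  exact: (eq_cov Ou sY (XX' u Ou) (fun _ _ => erefl)).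
have e4 : c (c Y X) Z u = c (c Y X') Z u.
  apply: (eq_cov Ou sZ _ (fun _ _ => erefl)).
  exact: (eq_cov Ou sX (erefl (Y u)) XX').
have alg (t1 t2 t3 t4 s1 s2 s3 s4 : 'rV[R]_n) : t1 = s1 -> t2 = s2 ->
    t3 = s3 -> t4 = s4 -> - t1 + t2 + (t3 - t4) = - s1 + s2 + (s3 - s4).
  by move=> -> -> -> ->.
exact: etrans (curvatureE Ou sX sY sZ)
  (etrans (alg _ _ _ _ _ _ _ _ e1 e2 e3 e4) (esym (curvatureE Ou sX' sY sZ))).
Qed.

(** This is S (eta, Y) Z = 0 with nabla_Y eta replaced by Y in the bracket. *)
Lemma cov_eta_cov Y Z u : O u -> smooth Y -> smooth Z ->
  c eta (c Y Z) u = c Y (c eta Z) u + c (c eta Y) Z u - c Y Z u.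
Proof.
move=> Ou sY sZ; have sE := smooth_eta hM sO.
have e : c (c Y eta) Z u = c Y Z u.
  by apply: (eq_cov Ou sZ _ (fun _ _ => erefl)); exact: cov_eta.
have alg (t1 t2 t3 t4 t5 : 'rV[R]_n) : 0 = - t1 + t2 + (t3 - t4) -> t4 = t5 ->
    t1 = t2 + t3 - t5.
  move=> H <-; apply: (addrI (- t1)); rewrite addNr H.
  by apply/rowP => j; rewrite !mxE; ring.
exact: alg (etrans (esym (curvature_eta Ou sY sZ)) (curvatureE Ou sE sY sZ)) e.
Qed.

(** Two steps of [cov_eta_cov] move nabla_eta through a second derivative. *)
Lemma cov_eta_cov_cov Y W U u : O u -> smooth Y -> smooth W -> smooth U ->
  c eta (c Y (c W U)) u =
  (c Y (c W (c eta U)) u + c Y (c (c eta W) U) u - c Y (c W U) u) +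
  c (c eta Y) (c W U) u - c Y (c W U) u.
Proof.
move=> Ou sY sW sU; have sE := smooth_eta hM sO.
have sWU := smooth_cov sW sU.
apply: etrans (cov_eta_cov Ou sY sWU) _.
apply: (congr1 (fun t => t + c (c eta Y) (c W U) u - c Y (c W U) u)).
have s1 := smooth_cov sW (smooth_cov sE sU).
have s2 := smooth_cov (smooth_cov sE sW) sU.
have s12 := smooth_pi_fieldD hM sO s1 s2.
apply: etrans (eq_cov Ou (smooth_cov sE sWU) (erefl (Y u))
  (fun w Ow => cov_eta_cov Ow sW sU)) _.
apply: etrans (covD Y Ou s12 (smooth_pi_fieldN hM sO sWU)) _.
by apply: congr2; [exact: covD|exact: covN].
Qed.

Lemma cov_eta_cov_covl Y W U u : O u -> smooth Y -> smooth W -> smooth U ->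
  c eta (c (c Y W) U) u =
  c (c Y W) (c eta U) u +
  (c (c Y (c eta W)) U u + c (c (c eta Y) W) U u - c (c Y W) U u) -
  c (c Y W) U u.
Proof.
move=> Ou sY sW sU; have sE := smooth_eta hM sO.
apply: etrans (cov_eta_cov Ou (smooth_cov sY sW) sU) _.
apply: (congr1 (fun t => c (c Y W) (c eta U) u + t - c (c Y W) U u)).
have e : c eta (c Y W) u =
    (fun w => (c Y (c eta W) w + c (c eta Y) W w) - c Y W w) u.
  exact: cov_eta_cov.
apply: etrans (eq_cov Ou sU e (fun _ _ => erefl)) _.
apply: etrans (covBl (fun w => c Y (c eta W) w + c (c eta Y) W w) (c Y W) Ou sU) _.
by apply: (congr1 (fun t => t - c (c Y W) U u)); exact: covDl.
Qed.

(** Each second derivative in S contributes twice its opposite through the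
    terms of order zero of [cov_eta_cov], and so does the bracket term; all other
    terms cancel against S with one argument differentiated. *)
Lemma vcov_eta_curvature Y W U u : O u -> smooth Y -> smooth W -> smooth U ->
  vcov A nabla eta S Y W U u = - (S Y W U u *+ 2).
Proof.
move=> Ou sY sW sU; have sE := smooth_eta hM sO.
have seY := smooth_cov sE sY; have seW := smooth_cov sE sW.
have seU := smooth_cov sE sU.
have sYWU := smooth_cov sY (smooth_cov sW sU).
have sWYU := smooth_cov sW (smooth_cov sY sU).
have sYW_U := smooth_cov (smooth_cov sY sW) sU.
have sWY_U := smooth_cov (smooth_cov sW sY) sU.
have e : c eta (S Y W U) u =
    - c eta (c Y (c W U)) u + c eta (c W (c Y U)) u +
    (c eta (c (c Y W) U) u - c eta (c (c W Y) U) u).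
  have sN1 := smooth_pi_fieldN hM sO sYWU; have sN2 := smooth_pi_fieldN hM sO sWY_U.
  apply: etrans (eq_cov Ou (smooth_curvature sY sW sU) (erefl (eta u))
    (fun w Ow => curvatureE Ow sY sW sU)) _.
  apply: etrans (covD eta Ou (smooth_pi_fieldD hM sO sN1 sWYU)
    (smooth_pi_fieldD hM sO sYW_U sN2)) _.
  apply: congr2.
    apply: etrans (covD eta Ou sN1 sWYU) _.
    by apply: (congr1 (fun t => t + _)); exact: covN.
  apply: etrans (covD eta Ou sYW_U sN2) _.
  by apply: (congr1 (fun t => _ + t)); exact: covN.
have alg (x0 x1 x2 x3 x4 P Q T V p q r s y1 y2 y3 y4 y5 y6 y7 y8 y9 y10 y11 y12
      : 'rV[R]_n) :
    x0 = - P + Q + (T - V) ->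
    P = (y1 + y3 - p) + y5 - p -> Q = (y2 + y4 - q) + y6 - q ->
    T = y7 + (y9 + y10 - r) - r -> V = y8 + (y11 + y12 - s) - s ->
    x1 = - y5 + y4 + (y10 - y11) -> x2 = - y3 + y6 + (y9 - y12) ->
    x3 = - y1 + y2 + (y7 - y8) -> x4 = - p + q + (r - s) ->
    x0 - x1 - x2 - x3 = - (x4 *+ 2).
  move=> -> -> -> -> -> -> -> -> ->.
  by apply/rowP => j; rewrite mulr2n !mxE; ring.
exact: alg e (cov_eta_cov_cov Ou sY sW sU) (cov_eta_cov_cov Ou sW sY sU)
  (cov_eta_cov_covl Ou sY sW sU) (cov_eta_cov_covl Ou sW sY sU)
  (curvatureE Ou seY sW sU) (curvatureE Ou sY seW sU)
  (curvatureE Ou sY sW seU) (curvatureE Ou sY sW sU).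
Qed.

(** Differentiate S (eta, Y) Z = 0: only the term in which eta is
    differentiated survives, and its derivative along X is X. *)
Lemma vcov_curvature_eta X Y Z u : O u -> smooth X -> smooth Y -> smooth Z ->
  vcov A nabla X S eta Y Z u = - S X Y Z u.
Proof.
move=> Ou sX sY sZ; have sE := smooth_eta hM sO.
have e1 : c X (S eta Y Z) u = 0.
  apply: etrans (eq_cov Ou (smooth_curvature sE sY sZ) (erefl (X u))
    (fun w Ow => curvature_eta Ow sY sZ)) _.
  exact: cov0.
have e2 : S (c X eta) Y Z u = S X Y Z u.
  by apply: (eq_curvature_l Ou (smooth_cov sX sE) sY sZ) => w; exact: cov_eta.
have e3 := curvature_eta Ou (smooth_cov sX sY) sZ.
have e4 := curvature_eta Ou sY (smooth_cov sX sZ).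
have alg (t0 t1 t2 t3 s : 'rV[R]_n) : t0 = 0 -> t1 = s -> t2 = 0 -> t3 = 0 ->
    t0 - t1 - t2 - t3 = - s.
  by move=> -> -> -> ->; rewrite !subr0 sub0r.
exact: alg e1 e2 e3 e4.
Qed.

(** Of the terms of the second derivative two survive: differentiating the
    argument eta of nabla_eta S gives 2 S by homogeneity, and differentiating the
    direction eta gives - (nabla_Y S) (eta, W, U) = S (Y, W) U. *)
Lemma vcov2_curvature_eta Y W U u : O u -> smooth Y -> smooth W -> smooth U ->
  vcov2 A nabla S Y eta eta W U u = S Y W U u *+ 3.
Proof.
move=> Ou sY sW sU; have sE := smooth_eta hM sO.
have T0 V V' w : O w -> smooth V -> smooth V' ->
    vcov A nabla eta S eta V V' w = 0.
  move=> Ow sV sV'; apply: etrans (vcov_curvature_eta Ow sE sV sV') _.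
  by apply: etrans (congr1 -%R (curvature_eta Ow sV sV')) _; rewrite oppr0.
have sT : smooth (vcov A nabla eta S eta W U).
  exact: (smooth_pi_field_eq hM sO (fun w Ow => esym (T0 W U w Ow sW sU))
    (smooth_pi_field0 sO)).
have e1 : c Y (vcov A nabla eta S eta W U) u = 0.
  apply: etrans (eq_cov Ou sT (erefl (Y u)) (fun w Ow => T0 W U w Ow sW sU)) _.
  exact: cov0.
have sYE := smooth_cov sY sE.
have e2 : S (c Y eta) W U u = S Y W U u.
  by apply: (eq_curvature_l Ou sYE sW sU) => w; exact: cov_eta.
have e3 := vcov_eta_curvature Ou sYE sW sU.
have e4 := vcov_curvature_eta Ou sYE sW sU.
have e5 := T0 _ U u Ou (smooth_cov sY sW) sU.
have e6 := T0 W _ u Ou sW (smooth_cov sY sU).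
have alg (t0 t1 t2 t3 t4 s r : 'rV[R]_n) : t0 = 0 -> t1 = - (s *+ 2) -> t2 = 0 ->
    t3 = 0 -> t4 = - s -> s = r -> t0 - t1 - t2 - t3 - t4 = r *+ 3.
  by move=> -> -> -> -> -> ->; rewrite !subr0 sub0r !opprK -mulrSr.
exact: alg e1 e3 e5 e6 e4 e2.
Qed.

Lemma vcov_eq0 X (T : pi_tensor13 R n M) :
  (forall Y Z W, smooth Y -> smooth Z -> smooth W -> forall w, O w -> T Y Z W w = 0) ->
  smooth X -> forall Y Z W, smooth Y -> smooth Z -> smooth W ->
  forall w, O w -> vcov A nabla X T Y Z W w = 0.
Proof.
move=> T0 sX Y Z W sY sZ sW w Ow.
have sT : smooth (T Y Z W).
  exact: (smooth_pi_field_eq hM sO (fun v Ov => esym (T0 Y Z W sY sZ sW v Ov))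
    (smooth_pi_field0 sO)).
have e1 : c X (T Y Z W) w = 0.
  exact: etrans (eq_cov Ow sT (erefl (X w)) (T0 Y Z W sY sZ sW)) (cov0 X Ow).
have e2 := T0 _ _ _ (smooth_cov sX sY) sZ sW w Ow.
have e3 := T0 _ _ _ sY (smooth_cov sX sZ) sW w Ow.
have e4 := T0 _ _ _ sY sZ (smooth_cov sX sW) w Ow.
have alg (t0 t1 t2 t3 : 'rV[R]_n) : t0 = 0 -> t1 = 0 -> t2 = 0 -> t3 = 0 ->
    t0 - t1 - t2 - t3 = 0.
  by move=> -> -> -> ->; rewrite !subr0.
exact: alg e1 e2 e3 e4.
Qed.

End Sections.

Lemma recurrent_vanishes : Sv_recurrent A nabla -> Sv_vanishes A nabla.
Proof.
move=> [lam [_ rec]] O X Y Z sO sX sY sZ u Ou.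
have sE := smooth_eta hM sO.
apply: oppr_inj; rewrite oppr0.
apply: etrans (esym (vcov_curvature_eta sO Ou sX sY sZ)) _.
apply: etrans (rec O X _ Y Z sO sX sE sY sZ u Ou) _.
by apply: etrans (congr1 _ (curvature_eta sO Ou sY sZ)) (scaler0 _ _).
Qed.

Lemma recurrent2_vanishes : Sv_recurrent2 A nabla -> Sv_vanishes A nabla.
Proof.
move=> [theta [_ rec]] O X Y Z sO sX sY sZ u Ou.
have sE := smooth_eta hM sO.
have e : v_curvature A nabla X Y Z u *+ 3 = 0.
  apply: etrans (esym (vcov2_curvature_eta sO Ou sX sY sZ)) _.
  apply: etrans (rec O _ X _ Y Z sO sE sX sE sY sZ u Ou) _.
  exact: etrans (congr1 _ (curvature_eta sO Ou sY sZ)) (scaler0 _ _).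
by apply/eqP; move/eqP : e; rewrite -scaler_nat scaler_eq0 pnatr_eq0.
Qed.

Lemma vanishes_recurrent : Sv_vanishes A nabla -> Sv_recurrent A nabla.
Proof.
move=> van; exists (fun _ _ => 0); split.
  split=> [u _ a x y|O X sO sX i k]; first by rewrite mulr0 addr0.
  exact: Ck_cst.
move=> O X Y Z W sO sX sY sZ sW u Ou; rewrite scale0r.
by apply: (vcov_eq0 sO) Ou => // ? ? ? ? ? ?; exact: van.
Qed.

Lemma vanishes_recurrent2 : Sv_vanishes A nabla -> Sv_recurrent2 A nabla.
Proof.
move=> van; exists (fun _ _ _ => 0); split.
  split=> [u _ a x y z|u _ a x y z|O X Y sO sX sY i k].
  - by rewrite mulr0 addr0.
  - by rewrite mulr0 addr0.
  - exact: Ck_cst.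
move=> O X Y Z W U sO sX sY sZ sW sU u Ou; rewrite scale0r.
have v0 V : smooth_pi_field A O V -> forall Z W U, smooth_pi_field A O Z ->
    smooth_pi_field A O W -> smooth_pi_field A O U -> forall w, O w ->
    vcov A nabla V (v_curvature A nabla) Z W U w = 0.
  by move=> sV; apply: (vcov_eq0 sO) => // ? ? ? ? ? ?; exact: van.
have e1 := vcov_eq0 sO (v0 X sX) sY sZ sW sU Ou.
have e2 := v0 _ (smooth_cov sO sY sX) Z W U sZ sW sU u Ou.
exact: etrans (congr2 (fun a b => a - b) e1 e2) (subr0 _).
Qed.

End Manifold.

Theorem theorem3p29 (R : realType) (n : nat) (M : topologicalType)
    (A : chartedSpace R n M) (L : M * 'rV[R]_n -> R)
    (nabla : connection R n M)
    (hM : smooth_manifold A) (hL : finsler_manifold A L)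
    (hnabla : cartan_connection A nabla L) :
  (Sv_recurrent A nabla <-> Sv_vanishes A nabla) /\
  (Sv_vanishes A nabla <-> Sv_recurrent2 A nabla).
Proof.
split; split.
- exact: (recurrent_vanishes hM hL hnabla).
- exact: (vanishes_recurrent hM hnabla).
- exact: (vanishes_recurrent2 hM hnabla).
- exact: (recurrent2_vanishes hM hL hnabla).
Qed.
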